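(* (i) For any integer $d\ge 2$ with $d\neq 4,5$, there exist positive constants $c_d, n_d$ such that for any real numbers $t_1,t_2\ge 1$ and every separated point set $P\subset\mathbb{R}^d$ with $n\ge n_d$ elements, the number of unordered pairs of distinct points of $P$ whose distance belongs to the set $[t_1,t_1+c_d n^{1/d}]\cup[t_2,t_2+c_d n^{1/d}]$ is at most $$T\bigl(m(d-1)+1,\,n\bigr)=\frac{n^2}{2}\left(1-\frac{1}{m(d-1)}\right)+O_d(1).$$ (ii) For $d=4$ or $d=5$ and for any $\varepsilon>0$, there exist positive constants $c_{d,\varepsilon}, n_{d,\varepsilon}$ such that for any real numbers $t_1,t_2\ge 1$ and every separated point set $P\subset\mathbb{R}^d$ with $n\ge n_{d,\varepsilon}$ elements, the number of unordered pairs of distinct points of $P$ whose distance belongs to the set $[t_1,t_1+c_{d,\varepsilon}(\log n)^{1/d}]\cup[t_2,t_2+c_{d,\varepsilon}(\log n)^{1/d}]$ is at most $$\frac{n^2}{2}\left(1-\frac{1}{m(d-1)}+\varepsilon\right).$$ (iii) These upper bounds cannot be reduced to $T(m(d-1)+1,n)-1$, for any $d$ and $n$. That is, for every integer $d\ge 2$, every integer $n\ge 1$, and whatever the positive constants $c_d$ (for $d\ne 4,5$) or $c_{d,\varepsilon}$ (for $d=4,5$) are, there exist $t_1,t_2\ge 1$ and a separated $n$-element set $P\subset\mathbb{R}^d$ for which the number of unordered pairs of distinct points of $P$ with distance in the respective union of two intervals (from (i) if $d\neq 4,5$, from (ii) if $d=4,5$) is at least $T(m(d-1)+1,n)$.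
   Context: A point set $P\subset\mathbb{R}^d$ is separated if the (Euclidean) distance between any two distinct points of $P$ is at least $1$. For integers $k,n\ge 1$, the Turán number $T(k,n)$ is the maximum number of edges of a (simple) graph on $n$ vertices that contains no complete subgraph $K_k$ on $k$ vertices. A set determines a distance $t>0$ if it has two points at distance $t$ from each other. A finite subset of $\mathbb{R}^d$ is a two-distance set if it determines at most two distinct positive distances. For $d\ge1$, $m(d)$ denotes the maximum cardinality of a two-distance set in $\mathbb{R}^d$ (this maximum exists). $O_d(1)$ denotes a quantity whose absolute value is bounded by a constant depending only on $d$. *)

(* Defs.v *)
From HB Require Import structures.
From mathcomp Require Import all_boot all_order all_algebra.
From mathcomp Require Import finmap.
From mathcomp Require Import all_classical all_reals all_analysis.

Set Implicit Arguments.
Unset Strict Implicit.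
Unset Printing Implicit Defensive.

Import Order.TTheory GRing.Theory Num.Theory.
Local Open Scope fset_scope.
Local Open Scope ring_scope.

(* The norm that the library puts on 'rV[R]_d is the sup norm, hence the
   explicit Euclidean distance. *)
Definition eucl_dist (R : realType) (d : nat) (x y : 'rV[R]_d) : R :=
  Num.sqrt (\sum_(i < d) (x 0 i - y 0 i) ^+ 2).

Definition unit_separated (R : realType) (d : nat) (P : {fset 'rV[R]_d}) : Prop :=
  forall x y, x \in P -> y \in P -> x != y -> 1 <= eucl_dist x y.

(* An unordered pair is the two-element set [fset x; y], so it is counted
   once. *)
Definition npairs (R : realType) (d : nat) (P : {fset 'rV[R]_d})
    (D : set R) : nat :=
  #|` [fset [fset x; y] | x in P, y in P & (x != y) && (eucl_dist x y \in D)] |.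

Definition distances (R : realType) (d : nat) (S : {fset 'rV[R]_d}) :
    {fset R} :=
  [fset eucl_dist x y | x in S, y in S & 0 < eucl_dist x y].

Definition two_distance (R : realType) (d : nat) (S : {fset 'rV[R]_d}) : Prop :=
  (#|` distances S| <= 2)%N.

Definition is_max_two_distance (R : realType) (d k : nat) : Prop :=
  (exists2 S : {fset 'rV[R]_d}, two_distance S & #|` S| = k) /\
  (forall S : {fset 'rV[R]_d}, two_distance S -> (#|` S| <= k)%N).

(* The maximum exists for every d, so the default value 0 is never used. *)
Definition max_two_distance (R : realType) (d : nat) : nat :=
  xget 0%N [set k | is_max_two_distance R d k]%classic.

(* Simple graphs on 'I_n are given by their edge sets. *)
Definition simple_graph (n : nat) (E : {set {set 'I_n}}) : bool :=
  [forall e in E, (#|e| == 2)%N].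

Definition has_clique (n : nat) (E : {set {set 'I_n}}) (k : nat) : bool :=
  [exists A : {set 'I_n}, (#|A| == k) &&
    [forall x in A, forall y in A, (x != y) ==> ([set x; y]%SET \in E)]].

Definition turan (k n : nat) : nat :=
  (\max_(E : {set {set 'I_n}} | simple_graph E && ~~ has_clique E k) #|E|)%N.

Definition near_two (R : realType) (t1 t2 w : R) : set R :=
  (`[t1, t1 + w] `|` `[t2, t2 + w])%classic.

(* Main.v *)
Require Import Defs.
From HB Require Import structures.
From mathcomp Require Import all_boot all_order all_algebra.
From mathcomp Require Import finmap.
From mathcomp Require Import all_classical all_reals all_analysis.
From mathcomp Require Import zify ring lra.

(** Let [m] be the maximal size of a two-distance set in dimension [d - 1].

    Upper bound. Join two of the [n] points when their distance is near [t1] or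
    [t2], and suppose that this graph has more than [turan m.+1 n] edges. Then some
    edge [x y] lies in at least [delta * n ^ (m - 1)] cliques on [m + 1] vertices
    ([many_cliques_through_edge]): maximizing edges minus a multiple of the squared
    order gives a subgraph of linear order with almost the Turan minimum degree
    and still containing a clique on [m + 1] vertices; a convexity argument finds
    an edge of that clique with codegree above the Turan value, and the other
    vertices are chosen greedily.

    By packing, a separated set has few points in a region that is small compared
    with [n ^ (1 / d)]. The width [w] is a small multiple of [n ^ (1 / d)], so in
    most of these cliques every vertex other than [x] and [y] can be moved to
    another point of the set, at distance much larger than [w] but much smaller
    than the distances in the clique, keeping all these distances in their
    intervals ([exists_clique_config]).

    Such a move is almost orthogonal to all edges at the moved vertex. Assuming
    such cliques with errors tending to zero, take limits along an ultrafilter. If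
    [t1 / t2] has a positive limit, the rescaled clique tends to a two-distance set
    with [m + 1] points in a hyperplane, a contradiction. If [t1 / t2] tends to 0,
    the clique splits into [a] clusters; at the scale [t2] they form a regular
    simplex, at the scale [t1] each cluster of [b] points containing a movable
    vertex forms another one, and these simplices and the limit direction of the
    move are mutually orthogonal, so [(a - 1) + (b - 1) + 1 <= d]
    ([free_cluster_bound]). Hence there are at most [a * (d + 1 - a)], or at most
    [d + 1], vertices, and neither exceeds [m] ([max_two_distance_ge]): for
    [4 <= d] because the sums of two basis vectors form a two-distance set of
    ['C(d, 2)] points in a hyperplane, for [d = 2, 3] by small examples.

    The argument is uniform in [2 <= d], and the bound for [d = 4, 5] follows from
    it since the logarithmic width is smaller and [turan m.+1 n] is at most
    [n ^ 2 / 2 * (1 - 1 / m)].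

    Sharpness. The Turan number is at most the number of edges of some complete
    [m]-partite graph. Dilate a two-distance set with [m] points enormously and
    replace each point by equally spaced points on a line orthogonal to the
    hyperplane: points on different lines are then joined
    ([turan_le_npairs]). *)

Set Implicit Arguments.
Unset Strict Implicit.
Unset Printing Implicit Defensive.

Import Order.TTheory GRing.Theory Num.Theory.
Local Open Scope fset_scope.
Local Open Scope ring_scope.

(** * Graphs, degrees and Turan's theorem *)

Section Turan.
Import mathcomp.boot.fintype mathcomp.boot.finset.
Local Open Scope nat_scope.

Definition nbrs (V : finType) (e : rel V) (A : {set V}) (x : V) : {set V} :=
  [set y in A | e x y].

(** Each edge inside [A] is counted twice. *)
Definition arcs (V : finType) (e : rel V) (A : {set V}) : nat :=
  \sum_(x in A) #|nbrs e A x|.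

Definition is_clique (V : finType) (e : rel V) (Q : {set V}) : Prop :=
  {in Q &, forall x y, x != y -> e x y}.

Definition diff_color (V : Type) (f : V -> nat) : rel V :=
  fun x y => f x != f y.

Lemma nbrs_sub (V : finType) (e : rel V) (A : {set V}) x : nbrs e A x \subset A.
Proof. by apply/subsetP=> y; rewrite inE => /andP[]. Qed.

Lemma is_clique1 (V : finType) (e : rel V) x : is_clique e [set x].
Proof. by move=> y z; rewrite !inE => /eqP-> /eqP->; rewrite eqxx. Qed.

Lemma sum_nbrsC (V : finType) (e : rel V) (B C : {set V}) : symmetric e ->
  \sum_(x in B) #|nbrs e C x| = \sum_(y in C) #|nbrs e B y|.
Proof.
move=> esym.
have E (D : {set V}) x : #|nbrs e D x| = \sum_(y in D) (e x y : nat).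
  rewrite -sum1_card big_mkcond /= [RHS]big_mkcond /=; apply: eq_bigr => y _.
  by rewrite inE; case: (y \in D); case: (e x y).
under eq_bigr do rewrite E.
rewrite exchange_big /=; apply: eq_bigr => y _; rewrite E.
by apply: eq_bigr => x _; rewrite esym.
Qed.

Lemma card_nbrs_split (V : finType) (e : rel V) (A B : {set V}) x :
  B \subset A -> #|nbrs e A x| = #|nbrs e B x| + #|nbrs e (A :\: B) x|.
Proof.
move=> sBA; rewrite -cardsUI.
have -> : nbrs e B x :&: nbrs e (A :\: B) x = set0.
  by apply/setP=> y; rewrite !inE; case: (y \in B); rewrite ?andbF.
rewrite cards0 addn0; congr #|pred_of_set _|; apply/setP=> y; rewrite !inE.
by case: (boolP (y \in B)) => [/(subsetP sBA) ->|_]; rewrite ?orbF.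
Qed.

(** Erdos's argument: the neighbourhood [B] of a vertex of maximal degree has
    no clique on [m] vertices, so it can be coloured inductively; giving the
    rest of [A] one new colour loses nothing, since each vertex outside [B]
    has degree at most [#|B|]. *)
Lemma clique_free_coloring (V : finType) (e : rel V) (m : nat) (A : {set V}) :
  symmetric e -> irreflexive e ->
  (forall Q : {set V}, Q \subset A -> is_clique e Q -> #|Q| <= m) ->
  exists f : V -> nat, {in A, forall x, f x < m} /\
    arcs e A <= arcs (diff_color f) A.
Proof.
move=> esym eirr; elim: m A => [|m IH] A hA.
  exists (fun=> 0); split=> [x xA|].
    by have := hA [set x]; rewrite sub1set xA cards1 => /(_ isT (@is_clique1 _ _ _)).
  have -> : A = set0; last by rewrite /arcs !big_set0.
  apply/setP=> x; rewrite inE; apply/negP=> xA.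
  by have := hA [set x]; rewrite sub1set xA cards1 => /(_ isT (@is_clique1 _ _ _)).
have [->|[v0 v0A]] := set_0Vmem A.
  by exists (fun=> 0); split=> [x|]; rewrite ?inE // /arcs !big_set0.
case: (arg_maxnP (fun v => #|nbrs e A v|) v0A) => v vA0 vmax; have vA : v \in A := vA0.
set B := nbrs e A v.
have sBA : B \subset A by apply: nbrs_sub.
have [|f [fB le_f]] := IH B.
  move=> Q sQB cQ; have vQ : v \notin Q.
    by apply/negP=> /(subsetP sQB); rewrite inE eirr andbF.
  have := hA (v |: Q); rewrite cardsU1 vQ add1n ltnS; apply.
    by rewrite subUset sub1set vA (subset_trans sQB sBA).
  move=> x y; rewrite !inE => /orP[/eqP->|xQ] /orP[/eqP->|yQ].
  - by rewrite eqxx.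
  - by move=> _; have := subsetP sQB y yQ; rewrite inE => /andP[].
  - by move=> _; have := subsetP sQB x xQ; rewrite inE esym => /andP[].
  - exact: cQ.
pose g x := if x \in B then f x else m.
exists g; split=> [x xA|].
  by rewrite /g; case: ifP => // xB; rewrite ltnS ltnW // fB.
have splitA (F : V -> nat) :
    \sum_(x in A) F x = \sum_(x in B) F x + \sum_(x in A :\: B) F x.
  rewrite (big_setID B) /=; congr (_ + _); apply: eq_bigl => x.
  by rewrite (setIidPr sBA).
have up : arcs e A <= arcs e B + (#|A :\: B| * #|B|).*2.
  rewrite /arcs splitA.
  under eq_bigr do rewrite (card_nbrs_split _ _ sBA).
  rewrite big_split /= -addnA leq_add2l (sum_nbrsC _ _ esym) -addnn.
  by apply: leq_add; rewrite -sum_nat_const; apply: leq_sum => x;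
     rewrite inE => /andP[_ xA]; apply: leq_trans (vmax x xA);
     rewrite ?leqnn // subset_leq_card //; apply/subsetP=> y;
     rewrite !inE => /andP[/andP[-> _] ->].
apply: leq_trans up _; apply: leq_trans (leq_add le_f (leqnn _)) _.
rewrite /arcs splitA -addnn addnA; apply: leq_add.
  rewrite mulnC -sum_nat_const -big_split; apply: leq_sum => x xB.
  rewrite (card_nbrs_split _ _ sBA); apply: leq_add; apply: subset_leq_card.
    apply/subsetP=> y; rewrite inE => /andP[yB fxy].
    by rewrite inE yB /diff_color /g xB yB.
  apply/subsetP=> y; rewrite inE => /andP[/negPf yB yA].
  rewrite inE in_setD yB yA /diff_color /g xB yB /=.
  by rewrite neq_ltn fB.
rewrite -sum_nat_const; apply: leq_sum => x; rewrite inE => /andP[/negPf xB xA].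
apply: subset_leq_card; apply/subsetP=> y yB; rewrite !inE (subsetP sBA) //=.
by rewrite /diff_color /g xB yB neq_ltn fB // orbT.
Qed.

Definition adj (n : nat) (E : {set {set 'I_n}}) : rel 'I_n :=
  fun i j => [set i; j]%SET \in E.

Definition edges_of (n : nat) (e : rel 'I_n) : {set {set 'I_n}} :=
  [set B | [exists i, exists j, e i j && (B == [set i; j]%SET)]].

Lemma adj_sym n (E : {set {set 'I_n}}) : symmetric (adj E).
Proof. by move=> i j; rewrite /adj setUC. Qed.

Lemma adj_irr n (E : {set {set 'I_n}}) : simple_graph E -> irreflexive (adj E).
Proof.
move=> /forallP sE i; rewrite /adj setUid; apply/negP => iE.
by have := implyP (sE _) iE; rewrite cards1.
Qed.

Lemma set2_eq (T : finType) (a b c : T) : [set a; b]%SET = [set a; c]%SET -> b = c.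
Proof.
move=> /setP E; have := E b; rewrite !inE eqxx orbT => /esym/orP[/eqP ba|/eqP //].
by have := E c; rewrite !inE eqxx orbT ba orbb => /eqP ->.
Qed.

Lemma adj_edges_of n (e : rel 'I_n) : symmetric e -> irreflexive e ->
  adj (edges_of e) =2 e.
Proof.
move=> esym eirr i j; rewrite /adj inE; apply/existsP/idP => [[a]|eij].
  move=> /existsP[b /andP[eab /eqP E]].
  have: i \in [set a; b]%SET by rewrite -E set21.
  rewrite !inE => /orP[] /eqP Ei; move: E; rewrite Ei.
    by move=> /set2_eq ->.
  by rewrite [RHS]setUC => /set2_eq ->; rewrite esym.
by exists i; apply/existsP; exists j; rewrite eij eqxx.
Qed.

Lemma simple_edges_of n (e : rel 'I_n) : irreflexive e -> simple_graph (edges_of e).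
Proof.
move=> eirr; apply/forallP=> B; apply/implyP; rewrite inE => /existsP[i].
move=> /existsP[j /andP[eij /eqP->]]; rewrite cards2.
by case: (eqVneq i j) eij => [->|//]; rewrite eirr.
Qed.

Lemma card_edges n (E : {set {set 'I_n}}) : simple_graph E ->
  arcs (adj E) [set: 'I_n] = #|E|.*2.
Proof.
move=> sE; have E2 B : B \in E -> #|B| = 2.
  by move=> BE; apply/eqP; apply: (implyP (forallP sE B)).
have deg i : #|nbrs (adj E) setT i| = \sum_(B in E) (i \in B : nat).
  transitivity #|[set B in E | i \in B]|.
    rewrite -(@card_in_imset _ _ (fun j => [set i; j]%SET)); last first.
      by move=> j k _ _; apply: set2_eq.
    congr #|pred_of_set _|; apply/setP=> B; rewrite !inE.
    apply/imsetP/andP => [[j]|[BE iB]].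
      by rewrite inE => /andP[_ jE] ->; split; [exact: jE | exact: set21].
    have /eqP/cards2P[a [b [nab EB]]] := E2 B BE.
    move: iB BE; rewrite EB => /set2P[] -> abE.
      by exists b => //; rewrite inE in_setT.
    exists a; last by rewrite setUC.
    by rewrite inE in_setT /adj setUC.
  rewrite -sum1_card big_mkcond /= [RHS]big_mkcond /=; apply: eq_bigr => B _.
  by rewrite inE; case: (B \in E); case: (i \in B).
rewrite /arcs; under eq_bigr do rewrite deg.
rewrite exchange_big /= (eq_bigr (fun=> 2)) => [|B BE].
  by rewrite sum_nat_const muln2.
rewrite -(E2 B BE) -sum1_card [RHS]big_mkcond /=; apply: eq_big => i.
  by rewrite inE.
by case: (i \in B).
Qed.

Lemma subset_card_exists (T : finType) (A : {set T}) k : k <= #|A| ->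
  exists2 B : {set T}, B \subset A & #|B| = k.
Proof.
rewrite cardE => kA; exists [set x in take k (enum A)].
  by apply/subsetP=> x; rewrite inE => /mem_take; rewrite mem_enum.
by rewrite cardsE (card_uniqP _) ?take_uniq ?enum_uniq // size_takel.
Qed.

Lemma has_cliqueP n (E : {set {set 'I_n}}) k :
  reflect (exists2 Q : {set 'I_n}, is_clique (adj E) Q & k <= #|Q|) (has_clique E k).
Proof.
apply: (iffP existsP) => [[A /andP[/eqP cA /forallP hA]]|[Q cQ kQ]].
  exists A; last by rewrite cA.
  move=> x y xA yA; have /forallP/(_ y) := implyP (hA x) xA.
  by move=> /implyP/(_ yA)/implyP.
have [B sBQ cB] := subset_card_exists kQ; exists B; rewrite cB eqxx /=.
apply/forallP=> x; apply/implyP=> xB; apply/forallP=> y; apply/implyP=> yB.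
by apply/implyP; apply: cQ; apply: (subsetP sBQ).
Qed.

(** Only this inequality about extremal graphs matters for sharpness: the
    construction realizes every complete multipartite graph. *)
Lemma turan_coloring m n : 0 < m -> exists f : 'I_n -> nat,
  (forall i, f i < m) /\ (turan m.+1 n).*2 <= arcs (diff_color f) [set: 'I_n].
Proof.
move=> m0; rewrite /turan.
apply: (big_ind (fun k => exists f : 'I_n -> nat, (forall i, f i < m) /\
  k.*2 <= arcs (diff_color f) [set: 'I_n])).
- by exists (fun=> 0); split.
- move=> a b [f [hf lf]] [g [hg lg]].
  by case: (leqP a b) => _; [exists g | exists f].
move=> E /andP[sE nE].
have [||Q _ cQ|f [hf le_f]] := @clique_free_coloring _ (adj E) m setT.
- exact: adj_sym.
- exact: adj_irr.
- rewrite leqNgt; apply: contra nE => mQ; apply/has_cliqueP.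
  by exists Q.
by exists f; split=> [i|]; [apply: hf | rewrite -card_edges].
Qed.
End Turan.

Section TuranBounds.
Import mathcomp.boot.fintype mathcomp.boot.finset.
Local Open Scope nat_scope.

Definition color_class (V : finType) (f : V -> nat) (A : {set V}) (r : nat) :
  {set V} := [set i in A | f i == r].

Lemma sum_color_class m (V : finType) (f : V -> nat) (A : {set V}) :
  {in A, forall x, f x < m} -> \sum_(r < m) #|color_class f A r| = #|A|.
Proof.
move=> hf; transitivity (\sum_(r < m) \sum_(x in A | f x == r) 1).
  by apply: eq_bigr => r _; rewrite -sum1_card; apply: eq_bigl => i; rewrite inE.
rewrite (exchange_big_dep (mem A)) /= => [|r x _ /andP[] //].
rewrite -sum1_card; apply: eq_bigr => x xA.
rewrite (big_pred1 (Ordinal (hf x xA))) // => r /=.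
by rewrite xA eq_sym.
Qed.

Lemma arcs_diff_color m (V : finType) (f : V -> nat) (A : {set V}) :
  {in A, forall x, f x < m} ->
  arcs (diff_color f) A + \sum_(r < m) #|color_class f A r| ^ 2 = #|A| ^ 2.
Proof.
move=> hf.
have -> : \sum_(r < m) #|color_class f A r| ^ 2 =
    \sum_(x in A) #|color_class f A (f x)|.
  transitivity (\sum_(r < m) \sum_(x in A | f x == r) #|color_class f A r|).
    apply: eq_bigr => r _; rewrite sum_nat_const expnS expn1; congr (_ * _).
    by apply: eq_card => x; rewrite inE.
  rewrite (exchange_big_dep (mem A)) /= => [|r x _ /andP[] //].
  apply: eq_bigr => x xA; rewrite (big_pred1 (Ordinal (hf x xA))) // => r /=.
  by rewrite xA eq_sym.
rewrite -big_split /= (eq_bigr (fun=> #|A|)) => [|x xA].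
  by rewrite sum_nat_const expnS expn1.
rewrite addnC -(cardsID (color_class f A (f x)) A); congr (_ + _).
  by apply: eq_card => y; rewrite !inE; case: (y \in A).
by apply: eq_card => y; rewrite !inE eq_sym; case: (y \in A); rewrite ?andbF ?andbT.
Qed.

Lemma coloring_clique m (V : finType) (f : V -> nat) (Q : {set V}) :
  (forall x, f x < m) -> is_clique (diff_color f) Q -> #|Q| <= m.
Proof.
move=> hf cQ; pose g x := Ordinal (hf x).
rewrite -[leqRHS]card_ord -(@card_in_imset _ _ g); first exact: max_card.
move=> i j iQ jQ /(congr1 val) /= fij; apply/eqP; apply: contraT => nij.
by have := cQ i j iQ jQ nij; rewrite /diff_color fij eqxx.
Qed.

(** A clique of a complete multipartite graph has at most one vertex of each
    colour, so the graph of [diff_color f] competes in the maximum. *)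
Lemma arcs_diff_color_le_turan m n (f : 'I_n -> nat) : (forall i, f i < m) ->
  arcs (diff_color f) [set: 'I_n] <= (turan m.+1 n).*2.
Proof.
move=> hf; have fsym : symmetric (diff_color f).
  by move=> i j; rewrite /diff_color eq_sym.
have firr : irreflexive (diff_color f) by move=> i; rewrite /diff_color eqxx.
have sE := simple_edges_of firr.
have -> : arcs (diff_color f) setT = arcs (adj (edges_of (diff_color f))) setT.
  apply: eq_bigr => i _; apply: eq_card => j; rewrite !inE.
  by rewrite (adj_edges_of fsym firr).
rewrite card_edges // leq_double /turan; apply: (leq_bigmax_cond (P := fun E => _)).
rewrite sE /=; apply/has_cliqueP => -[Q cQ].
rewrite ltnNge => /negP; apply; apply: (coloring_clique hf).
by move=> i j iQ jQ nij; rewrite -(adj_edges_of fsym firr); apply: cQ.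
Qed.

Lemma card_modn m n r : r < m ->
  #|color_class (fun i : 'I_n => i %% m) setT r| = (n + (m - r.+1)) %/ m.
Proof.
move=> rm; rewrite -sum1_card.
under eq_bigl do rewrite inE in_setT.
rewrite -(big_mkord (fun i => i %% m == r) (fun=> 1)).
elim: n => [|n IH].
  by rewrite big_geq // divn_small //; lia.
rewrite big_mkcond big_nat_recr //= -big_mkcond IH addSn divnS; last lia.
rewrite addnC; congr (_ + _).
have -> : (n + (m - r.+1)).+1 = n + m - r by lia.
rewrite -eqn_mod_dvd ?modnDr; last lia.
by rewrite eq_sym (modn_small rm) eq_sym; case: eqP.
Qed.
End TuranBounds.

Section TuranAsymptotics.
Variable R : realType.

(** Cauchy-Schwarz with its defect: the defect measures how far the classes are
    from being equal, which gives the upper bound for all colourings and the lower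
    bound for the balanced one. *)
Lemma sum_sqr_dev (m n : nat) (s : 'I_m -> nat) :
  (\sum_(r < m) s r)%N = n ->
  \sum_(r < m) (m%:R * (s r)%:R - n%:R) ^+ 2 =
  m%:R * (m%:R * (\sum_(r < m) s r ^ 2)%N%:R - n%:R ^+ 2) :> R.
Proof.
move=> sn.
have -> : \sum_(r < m) (m%:R * (s r)%:R - n%:R) ^+ 2 =
   \sum_(r < m) (m%:R ^+ 2 * (s r ^ 2)%:R - (2 * m%:R * n%:R) * (s r)%:R + n%:R ^+ 2) :> R.
  by apply: eq_bigr => r _; rewrite natrX; ring.
rewrite big_split /= sumrB -!mulr_sumr -!natr_sum sn sumr_const card_ord.
rewrite -[_ *+ m]mulr_natl.
ring.
Qed.

Import mathcomp.boot.fintype mathcomp.boot.finset.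

Lemma clique_free_arcs_le (V : finType) (e : rel V) (m : nat) (A : {set V}) :
  (0 < m)%N -> symmetric e -> irreflexive e ->
  (forall Q : {set V}, Q \subset A -> is_clique e Q -> (#|Q| <= m)%N) ->
  (arcs e A)%:R <= #|A|%:R ^+ 2 * (1 - m%:R^-1) :> R.
Proof.
move=> m0 esym eirr hA.
have [f [hf le_f]] := clique_free_coloring esym eirr hA.
have := arcs_diff_color hf.
have := sum_sqr_dev (sum_color_class hf).
set S := (\sum_(r < m) _ ^ 2)%N => dev arcsE.
have mR : 0 < m%:R :> R by rewrite ltr0n.
have Sn : #|A|%:R ^+ 2 <= m%:R * S%:R :> R.
  rewrite -subr_ge0 -(pmulr_rge0 _ mR) -dev.
  by apply: sumr_ge0 => r _; apply: sqr_ge0.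
have : (arcs e A + S)%:R <= (#|A| ^ 2)%:R :> R.
  by rewrite ler_nat -arcsE leq_add2r.
rewrite natrD natrX => h.
have Sn' : #|A|%:R ^+ 2 * m%:R^-1 <= S%:R :> R by rewrite ler_pdivrMr // mulrC.
by lra.
Qed.

Lemma turan_le (m n : nat) : (0 < m)%N ->
  (turan m.+1 n)%:R <= n%:R ^+ 2 / 2 * (1 - m%:R^-1) :> R.
Proof.
move=> m0; have [f [hf le_f]] := turan_coloring n m0.
have : (turan m.+1 n).*2%:R <= n%:R ^+ 2 * (1 - m%:R^-1) :> R.
  apply: (@le_trans _ _ (arcs (diff_color f) [set: 'I_n])%:R).
    by rewrite ler_nat.
  rewrite -[in leRHS](card_ord n) -cardsT; apply: clique_free_arcs_le => //.
  - by move=> i j; rewrite /diff_color eq_sym.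
  - by move=> i; rewrite /diff_color eqxx.
  by move=> Q _ /(coloring_clique hf).
rewrite -muln2 natrM => h.
by lra.
Qed.

(** The colouring modulo [m] has classes of sizes within [1] of [n / m]. *)
Lemma turan_ge (m n : nat) : (0 < m)%N ->
  n%:R ^+ 2 / 2 * (1 - m%:R^-1) - m%:R / 2 <= (turan m.+1 n)%:R :> R.
Proof.
move=> m0; pose f (i : 'I_n) := (i %% m)%N.
have hf i : (f i < m)%N by rewrite ltn_mod.
have := arcs_diff_color_le_turan hf.
have hfT : {in [set: 'I_n], forall x, (f x < m)%N} by [].
have := arcs_diff_color hfT.
have := sum_sqr_dev (sum_color_class hfT).
rewrite cardsT card_ord.
set S := (\sum_(r < m) _ ^ 2)%N => dev arcsE le_t.
have mR : 0 < m%:R :> R by rewrite ltr0n.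
have Sn : m%:R * S%:R <= n%:R ^+ 2 + m%:R ^+ 2 :> R.
  rewrite -(ler_pM2l mR) mulrDr -lerBlDl -mulrBr -dev.
  apply: (le_trans (y := \sum_(r < m) m%:R ^+ 2)); last first.
    by rewrite sumr_const card_ord -[_ *+ m]mulr_natl.
  apply: ler_sum => r _; rewrite card_modn //.
  set q := (_ %/ _)%N.
  have [g1 g2] : (m * q <= n + m)%N /\ (n <= m * q + m)%N.
    have := divn_eq (n + (m - r.+1)) m; rewrite -/q.
    have := ltn_pmod (n + (m - r.+1)) m0; have := ltn_ord r.
    by move: (_ %% _)%N => x; nia.
  have h1 : m%:R * q%:R <= n%:R + m%:R :> R by rewrite -natrM -natrD ler_nat.
  have h2 : n%:R <= m%:R * q%:R + m%:R :> R by rewrite -natrM -natrD ler_nat.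
  rewrite -subr_ge0 subr_sqr; apply: mulr_ge0; lra.
have Sn' : S%:R <= n%:R ^+ 2 * m%:R^-1 + m%:R :> R.
  rewrite -(ler_pM2l mR) mulrDr mulrCA mulfV ?mulr1 ?gt_eqF //.
have : (n ^ 2)%:R <= ((turan m.+1 n).*2 + S)%:R :> R.
  by rewrite ler_nat -arcsE leq_add2r.
rewrite natrD -muln2 natrM natrX => h.
by lra.
Qed.
End TuranAsymptotics.

(** * Many cliques through one edge above the Turan number *)

Section DenseCliques.
Import mathcomp.boot.fintype mathcomp.boot.finset.
Variable R : realType.

Definition codeg (V : finType) (e : rel V) (A : {set V}) (x y : V) : nat :=
  #|nbrs e A x :&: nbrs e A y|.

(** Both sides count the triples formed by two vertices of [Q] and a common
    neighbour in [A]. *)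
Lemma sum_codeg (V : finType) (e : rel V) (A Q : {set V}) : symmetric e ->
  (\sum_(x in Q) \sum_(y in Q) codeg e A x y = \sum_(v in A) #|nbrs e Q v| ^ 2)%N.
Proof.
move=> esym; rewrite /codeg.
have cE x y : #|nbrs e A x :&: nbrs e A y| =
    (\sum_(v in A) (e v x : nat) * (e v y : nat))%N.
  rewrite -sum1_card big_mkcond /= [RHS]big_mkcond /=; apply: eq_bigr => v _.
  rewrite !inE (esym v x) (esym v y).
  by case: (v \in A); case: (e x v); case: (e y v).
under eq_bigr do under eq_bigr do rewrite cE.
under eq_bigr do rewrite exchange_big /=.
rewrite exchange_big /=; apply: eq_bigr => v vA.
have -> : #|nbrs e Q v| = (\sum_(x in Q) (e v x : nat))%N.
  rewrite -sum1_card big_mkcond /= [RHS]big_mkcond /=; apply: eq_bigr => x _.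
  by rewrite inE; case: (x \in Q); case: (e v x).
rewrite expnS expn1 big_distrl /=; apply: eq_bigr => x xQ.
by rewrite big_distrr.
Qed.

(** In a clique [Q] with [m + 1] vertices whose degrees are nearly the Turan
    degree, a vertex of [A] has about [m - 1/m] neighbours in [Q] on average;
    since [f (f - 1)] lies above its chord through [m - 1] and [m], the average
    codegree inside [Q] exceeds that of the Turan graph. *)
Lemma exists_large_codeg (V : finType) (e : rel V) (A Q : {set V}) (m : nat) (D : R) :
  symmetric e -> irreflexive e -> (0 < m)%N -> #|Q| = m.+1 ->
  {in Q, forall x, D <= #|nbrs e A x|%:R} ->
  exists x y, [/\ x \in Q, y \in Q, x != y &
    2 * (m%:R - 1) * (m%:R + 1) * D - m%:R * (m%:R - 1) * #|A|%:R
    <= m%:R * (m%:R + 1) * (codeg e A x y)%:R].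
Proof.
move=> esym eirr m0 cQ hD; pose X := 2 * (m%:R - 1) * (m%:R + 1) * D - m%:R * (m%:R - 1) * #|A|%:R.
case: (pselect (exists x y, [/\ x \in Q, y \in Q, x != y & X <= m%:R * (m%:R + 1) *
  (codeg e A x y)%:R])) => // nex; exfalso.
have lt_X x y : x \in Q -> y \in Q :\ x -> m%:R * (m%:R + 1) * (codeg e A x y)%:R < X.
  move=> xQ; rewrite !inE => /andP[nyx yQ]; rewrite ltNge; apply/negP=> h.
  by apply: nex; exists x, y; rewrite eq_sym.
have mR : 1 <= m%:R :> R by rewrite ler1n.
have sumlt : \sum_(x in Q) \sum_(y in Q :\ x) m%:R * (m%:R + 1) * (codeg e A x y)%:R
     < \sum_(x in Q) \sum_(y in Q :\ x) X.
  have [z zQ] : exists z, z \in Q by apply/card_gt0P; rewrite cQ.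
  apply: ltr_sum; first by apply/hasP; exists z; rewrite ?mem_index_enum.
  move=> x xQ; apply: ltr_sum; last by move=> y; apply: lt_X.
  have [y yQ] : exists y, y \in Q :\ x.
    by apply/card_gt0P; have := cardsD1 x Q; rewrite xQ cQ; lia.
  by apply/hasP; exists y; rewrite ?mem_index_enum.
have cE : \sum_(x in Q) \sum_(y in Q :\ x) X = m%:R * (m%:R + 1) * X.
  rewrite (eq_bigr (fun=> m%:R * X)) => [|x xQ].
    by rewrite sumr_const cQ -[_ *+ m.+1]mulr_natl -addn1 natrD; ring.
  rewrite sumr_const; have := cardsD1 x Q; rewrite xQ cQ add1n => -[<-].
  by rewrite mulr_natl.
move: sumlt; rewrite cE.
under eq_bigr do rewrite -mulr_sumr.
rewrite -mulr_sumr ltr_pM2l; last by apply: mulr_gt0; lra.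
apply/negP; rewrite -leNgt.
have -> : \sum_(x in Q) \sum_(y in Q :\ x) (codeg e A x y)%:R =
   \sum_(v in A) (#|nbrs e Q v|%:R ^+ 2 - #|nbrs e Q v|%:R) :> R.
  rewrite sumrB -[X in _ = _ - X]natr_sum -(sum_nbrsC Q A esym).
  under [X in _ = X - _]eq_bigr do rewrite -natrX.
  rewrite -natr_sum -(sum_codeg _ _ esym) !natr_sum -sumrB; apply: eq_bigr => x xQ.
  by rewrite natr_sum (big_setD1 x xQ) /= /codeg setIid [X in _ = X - _]addrC addrK.
apply: (le_trans (y := \sum_(v in A) (2 * (m%:R - 1) * #|nbrs e Q v|%:R
    - m%:R * (m%:R - 1)))); last first.
  apply: ler_sum => v _; set f := #|_|.
  rewrite -subr_ge0.
  have -> : f%:R ^+ 2 - f%:R - (2 * (m%:R - 1) * f%:R - m%:R * (m%:R - 1)) =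
    (f%:R - m%:R) * (f%:R - m%:R + 1) :> R by ring.
  have [le_mf|lt_fm] := leqP m f.
    have : m%:R <= f%:R :> R by rewrite ler_nat.
    by move=> h; apply: mulr_ge0; lra.
  have : f.+1%:R <= m%:R :> R by rewrite ler_nat.
  by rewrite -addn1 natrD => h; apply: mulr_le0; lra.
rewrite sumrB -mulr_sumr sumr_const -natr_sum -(sum_nbrsC Q A esym) natr_sum /X.
have : (m%:R + 1) * D <= \sum_(x in Q) #|nbrs e A x|%:R.
  rewrite (_ : _ * D = \sum_(x in Q) D); first exact: ler_sum.
  by rewrite sumr_const cQ -[_ *+ m.+1]mulr_natl -addn1 natrD.
move=> h; rewrite -[m%:R * (m%:R - 1) *+ _]mulr_natr lerD2r -mulrA.
by apply: ler_wpM2l => //; lra.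
Qed.

Definition cliques_in (V : finType) (e : rel V) (H : {set V}) (r : nat) :
    {set r.-tuple V} :=
  [set t : r.-tuple V | all (mem H) t && pairwise e t].

(** Each vertex of [s] excludes at most [mu] vertices of [H]. *)
Lemma card_common_nbrs (V : finType) (e : rel V) (H : {set V}) (mu : R) (s : seq V) :
  symmetric e ->
  {in H, forall v, #|H :\: nbrs e H v|%:R <= mu} -> all (mem H) s ->
  #|H|%:R <= #|[set v in H | all (e v) s]|%:R + (size s)%:R * mu.
Proof.
move=> esym hmu; elim: s => [_|x s IH /= /andP[xH sH]].
  rewrite mul0r addr0 ler_nat; apply: subset_leq_card.
  by apply/subsetP=> v vH; rewrite inE vH.
apply: le_trans (IH sH) _; rewrite -addn1 natrD mulrDl mul1r addrA addrAC.
rewrite lerD2r.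
apply: (@le_trans _ _ (#|[set v in H | e v x && all (e v) s]|%:R +
  #|H :\: nbrs e H x|%:R)); last by rewrite lerD2l hmu.
rewrite -natrD ler_nat -cardsUI.
apply: leq_trans (leq_addr _ _); apply: subset_leq_card.
apply/subsetP=> v; rewrite !inE => /andP[-> ->] /=.
by rewrite (esym x v); case: (e v x).
Qed.

(** Greedy extension: when [j] vertices are chosen, at least [#|H| - j * mu]
    vertices remain for the next one, hence the bound with [r.-1]. *)
Lemma card_cliques_in (V : finType) (e : rel V) (H : {set V}) (mu delta : R) (r : nat) :
  symmetric e -> 0 <= mu -> 0 <= delta ->
  {in H, forall v, #|H :\: nbrs e H v|%:R <= mu} ->
  r.-1%:R * mu + delta <= #|H|%:R ->
  delta ^+ r <= #|cliques_in e H r|%:R.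
Proof.
move=> esym mu0 d0 hmu; elim: r => [_|r IH /= hr].
  rewrite expr0 ler1n; apply/card_gt0P; exists [tuple]; by rewrite inE.
have {}IH : delta ^+ r <= #|cliques_in e H r|%:R.
  apply: IH; apply: le_trans hr; rewrite lerD2r.
  by apply: ler_wpM2r => //; rewrite ler_nat leq_pred.
pose N (t : r.-tuple V) := [set v in H | all (e v) t].
pose S := [set p : V * r.-tuple V | (p.2 \in cliques_in e H r) && (p.1 \in N p.2)].
pose F (p : V * r.-tuple V) := [tuple of p.1 :: p.2].
have injF : injective F by move=> [v t] [w u] /(congr1 val) /= [-> /val_inj ->].
have sFS : F @: S \subset cliques_in e H r.+1.
  apply/subsetP=> u /imsetP[[v t] vtS ->]; move: vtS; rewrite !inE /=.
  by move=> /andP[/andP[tH tp] /andP[vH vt]]; rewrite vH tH vt tp.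
apply: (@le_trans _ _ #|S|%:R); last first.
  by rewrite ler_nat -(card_imset _ injF) subset_leq_card.
have -> : #|S| = (\sum_(t in cliques_in e H r) #|N t|)%N.
  rewrite -sum1_card.
  under [RHS]eq_bigr do rewrite -sum1_card.
  rewrite [RHS](exchange_big_dep xpredT) //= pair_big_dep /=.
  by apply: eq_bigl => -[v t]; rewrite inE.
rewrite natr_sum exprS.
apply: (@le_trans _ _ (\sum_(t in cliques_in e H r) delta)).
  by rewrite sumr_const -mulr_natl mulrC; apply: ler_wpM2r.
apply: ler_sum => t; rewrite inE => /andP[tH _].
have := card_common_nbrs esym hmu tH; rewrite size_tuple -/(N t) => h.
lra.
Qed.

Lemma arcs_setD1 (V : finType) (e : rel V) (A : {set V}) (v : V) :
  symmetric e -> irreflexive e -> v \in A ->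
  arcs e A = (arcs e (A :\ v) + (#|nbrs e A v|).*2)%N.
Proof.
move=> esym eirr vA; have sA : A :\ v \subset A by rewrite subD1set.
have AD : A :\: (A :\ v) = [set v].
  by apply/setP=> x; rewrite !inE; case: (eqVneq x v) => [->|] //=; case: (x \in A).
rewrite /arcs (big_setD1 v vA) /=.
under [X in (_ + X)%N = _]eq_bigr do rewrite (card_nbrs_split _ _ sA).
rewrite big_split /= AD (sum_nbrsC _ [set v] esym) big_set1.
have -> : #|nbrs e A v| = #|nbrs e (A :\ v) v|.
  apply: eq_card => x; rewrite !inE; case: (eqVneq x v) => [->|//].
  by rewrite eirr andbF.
by rewrite -addnn; lia.
Qed.
End DenseCliques.

Section DenseCliquesMain.
Import mathcomp.boot.fintype mathcomp.boot.finset.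
Variable R : realType.

Lemma turan_clique (k n : nat) (E : {set {set 'I_n}}) :
  simple_graph E -> (turan k n < #|E|)%N -> has_clique E k.
Proof.
move=> sE; apply: contraLR; rewrite -leqNgt => nE.
by apply: (leq_bigmax_cond (P := fun E => _)); rewrite sE.
Qed.

(** Maximizing [arcs e A - beta * #|A| ^ 2] selects a dense core: removing one
    vertex cannot increase the potential, which is the lower bound on degrees. *)
Lemma exists_dense_core (V : finType) (e : rel V) (beta : R) :
  symmetric e -> irreflexive e ->
  exists A : {set V},
    (arcs e setT)%:R - beta * #|V|%:R ^+ 2 <= (arcs e A)%:R - beta * #|A|%:R ^+ 2 /\
    {in A, forall v, beta * (2 * #|A|%:R - 1) <= 2 * #|nbrs e A v|%:R}.
Proof.
move=> esym eirr; pose phi (A : {set V}) := (arcs e A)%:R - beta * #|A|%:R ^+ 2 : R.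
case: (@Order.TotalTheory.arg_maxP _ _ _ setT xpredT phi isT) => A _ Amax.
exists A; split=> [|v vA].
  by have : phi setT <= phi A := Amax setT isT; rewrite /phi cardsT.
have : phi (A :\ v) <= phi A := Amax _ isT; rewrite /phi (arcs_setD1 esym eirr vA).
have -> : #|A|%:R = #|A :\ v|%:R + 1 :> R.
  by rewrite (cardsD1 v A) vA add1n -addn1 natrD.
by rewrite natrD -muln2 natrM; lra.
Qed.

(** The dense core contains a clique [Q] on [r + 2] vertices: by hypothesis if it
    is the whole graph, and otherwise because it exceeds the Turan density. One
    edge of [Q] has large codegree, and inside its common neighbourhood cliques on
    [r] vertices can be chosen greedily. *)
Lemma many_cliques_through_edge (r : nat) : (0 < r)%N -> exists (delta : R) (n0 : nat),
  0 < delta /\ forall (n : nat) (E : {set {set 'I_n}}), (n0 <= n)%N ->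
    simple_graph E -> (turan r.+2 n < #|E|)%N ->
    exists x y : 'I_n, adj E x y /\
      delta * n%:R ^+ r <=
      #|cliques_in (adj E) (nbrs (adj E) setT x :&: nbrs (adj E) setT y) r|%:R.
Proof.
move=> r0; have [m mE] : exists m : R, m = r.+1%:R by exists r.+1%:R.
have m1 : 1 <= m by rewrite mE ler1n.
(* With [mu = (1/m + 2 eta) a], the greedy step inside the common neighbourhood
   keeps [2 / (m^2 (m + 1)) - (4 (m - 1) / m + 2 (m - 2)) eta] of the vertices;
   this [eta] makes it at least [del]. *)
pose eta : R := (4 * m ^+ 2 * (m + 1) * (m + 2))^-1.
have eta0 : 0 < eta.
  by rewrite invr_gt0; do !apply: mulr_gt0 => //; try apply: exprn_gt0; lra.
have etaE : eta * (4 * m ^+ 2 * (m + 1) * (m + 2)) = 1.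
  by rewrite mulVf // gt_eqF // -invr_gt0.
pose del := (m ^+ 2 * (m + 1))^-1.
have del0 : 0 < del.
  by rewrite invr_gt0; apply: mulr_gt0; [apply: exprn_gt0|]; lra.
have delE : del = 4 * (m + 2) * eta.
  rewrite /del /eta; field; apply/andP; split; first by rewrite gt_eqF //; lra.
  by apply/andP; split; rewrite gt_eqF //; lra.
have minv : m^-1 * m = 1 by rewrite mulVf // gt_eqF //; lra.
have minv1 : m^-1 <= 1 by rewrite invf_le1 //; lra.
have minv0 : 0 < m^-1 by rewrite invr_gt0; lra.
have eta1 : eta <= 1 / 24.
  suff : 24 <= 4 * m ^+ 2 * (m + 1) * (m + 2).
    by move=> h; rewrite div1r lef_pV2 // posrE; lra.
  have h1 : 1 <= m ^+ 2 by rewrite expr2; nra.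
  have h2 : 6 <= (m + 1) * (m + 2) by nra.
  by rewrite -!mulrA; nra.
have e2 : m * m * m^-1 = m by rewrite mulfK // gt_eqF //; lra.
have e3 : m * (m + 1) * del = m^-1.
  by rewrite /del; field; rewrite !gt_eqF //; lra.
have e4 : m^-1 = 4 * eta * m * (m + 1) * (m + 2).
  by rewrite /eta; field; rewrite !gt_eqF //; lra.
clearbody del eta.
pose n0 := (Num.bound (4 * m / eta ^+ 2)).+1.
exists ((del * (eta / 2)) ^+ r), n0; split.
  by apply: exprn_gt0; apply: mulr_gt0 => //; lra.
move=> n E n0n sE tE; set e := adj E.
have esym : symmetric e by apply: adj_sym.
have eirr : irreflexive e by apply: adj_irr.
have nbig : 4 * m <= eta ^+ 2 * n%:R.
  rewrite [eta ^+ 2 * _]mulrC -ler_pdivrMr ?exprn_gt0 //.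
  apply: (@le_trans _ _ n0%:R); last by rewrite ler_nat.
  apply: ltW; apply: lt_trans (archi_boundP _) _; last by rewrite ltr_nat.
  by apply: divr_ge0; [|apply: sqr_ge0]; lra.
have nbig' : 4 * m <= eta * n%:R.
  have : 0 <= n%:R :> R by rewrite ler0n.
  by rewrite expr2 in nbig; nra.
pose beta := 1 - m^-1 - eta.
have [A [Aphi Adeg]] := exists_dense_core beta esym eirr.
set a : R := #|A|%:R in Aphi Adeg.
have a0 : 0 <= a by rewrite ler0n.
have an : a <= n%:R by rewrite /a ler_nat -[leqRHS]card_ord max_card.
(* The potential of the whole graph exceeds the Turan density by about
   [eta * n ^ 2], which forces the core to have linear size. *)
have Tphi : eta * n%:R ^+ 2 - m <= (arcs e A)%:R - beta * a ^+ 2.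
  apply: le_trans Aphi; rewrite card_ord card_edges // -muln2 natrM.
  have := turan_ge R n (ltn0Sn r); rewrite -mE => hT.
  have : (turan r.+2 n)%:R <= #|E|%:R :> R by rewrite ler_nat ltnW.
  by rewrite /beta; lra.
have Aub : (arcs e A)%:R <= a ^+ 2.
  rewrite /a -natrX ler_nat expnS expn1 /arcs -sum_nat_const.
  by apply: leq_sum => x _; apply: subset_leq_card; apply: nbrs_sub.
have beta0 : 0 <= beta + 1 by rewrite /beta; lra.
have n1 : 1 <= n%:R :> R by nra.
have abig : eta / 2 * n%:R <= a.
  have h1 : eta * n%:R ^+ 2 - m <= 2 * a ^+ 2.
    by apply: (le_trans Tphi); rewrite /beta; have := sqr_ge0 a; nra.
  have h2 : m <= eta / 4 * n%:R ^+ 2 by rewrite expr2; nra.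
  rewrite -(@ler_pXn2r _ 2) ?nnegrE //; last by apply: mulr_ge0; lra.
  have h3 : 0 <= n%:R ^+ 2 :> R by apply: sqr_ge0.
  have h4 : (eta / 2) ^+ 2 <= eta / 8 by rewrite expr2; nra.
  by rewrite exprMn; apply: le_trans (ler_wpM2r h3 h4) _; nra.
have agt : 1 / (2 * eta) <= a.
  apply: le_trans abig; rewrite ler_pdivrMr; last lra.
  by rewrite expr2 in nbig; nra.
have etaa : 1 / 2 <= eta * a by move: agt; rewrite ler_pdivrMr; lra.
have [Q sQA [cQ szQ]] : exists2 Q : {set 'I_n}, Q \subset A &
    is_clique e Q /\ #|Q| = r.+2.
  suff [Q sQA [cQ szQ]] : exists2 Q : {set 'I_n}, Q \subset A &
      is_clique e Q /\ (r.+2 <= #|Q|)%N.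
    have [B sBQ cB] := subset_card_exists szQ; exists B.
      exact: subset_trans sBQ sQA.
    by split=> // x y xB yB; apply: cQ; apply: (subsetP sBQ).
  (* A proper core gains more than the additive error [m] in the Turan bound. *)
  have [AT|nAT] := eqVneq A setT.
    by have /has_cliqueP[Q cQ szQ] := turan_clique sE tE; exists Q; rewrite ?AT.
  case: (pselect (exists2 Q : {set 'I_n}, Q \subset A &
    is_clique e Q /\ (r.+2 <= #|Q|)%N)) => // nQ; exfalso.
  have : (arcs e A)%:R <= a ^+ 2 * (1 - m^-1).
    rewrite mE; apply: clique_free_arcs_le => // Q sQA cQ; rewrite leqNgt; apply/negP => szQ.
    by apply: nQ; exists Q.
  have an1 : a + 1 <= n%:R.
    rewrite /a -[1]/(1%:R) -natrD ler_nat addn1 -[leqRHS]card_ord -cardsT.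
    by apply: proper_card; rewrite properEneq nAT subsetT.
  by move: Tphi; rewrite /beta; nra.
have Adeg' x : x \in A -> (1 - m^-1 - 2 * eta) * a <= #|nbrs e A x|%:R.
  by move=> xA; have := Adeg x xA; rewrite /beta; nra.
have [|x [y [xQ yQ nxy]]] := @exists_large_codeg R _ e A Q r.+1
  ((1 - m^-1 - 2 * eta) * a) esym eirr isT szQ.
  by move=> x xQ; apply: Adeg'; apply: (subsetP sQA).
rewrite -mE => cod; exists x, y; split; first by apply: cQ.
set H := nbrs e A x :&: nbrs e A y.
pose mu := (m^-1 + 2 * eta) * a.
have hmu : {in H, forall v, #|H :\: nbrs e H v|%:R <= mu}.
  move=> v; rewrite !inE => /andP[/andP[vA _] _].
  apply: (@le_trans _ _ #|A :\: nbrs e A v|%:R).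
    rewrite ler_nat; apply: subset_leq_card; apply/subsetP=> z; rewrite !inE.
    by case: (z \in A) => //=; case: (e x z) => //=; case: (e y z) => //=; case: (e v z).
  have := cardsID (nbrs e A v) A; rewrite (setIidPr (nbrs_sub _ _ _)).
  move=> /(congr1 (fun k => k%:R : R)); rewrite natrD -/a => cA.
  by have := Adeg' v vA; rewrite /mu; lra.
have Hbig : r.-1%:R * mu + del * a <= #|H|%:R.
  rewrite -/(codeg e A x y).
  have r1E : r.-1%:R = m - 2.
    by rewrite mE; case: (r) r0 => // k _; rewrite -[k.+2]addn2 natrD addrK.
  have mm0 : 0 < m * (m + 1) by apply: mulr_gt0; lra.
  rewrite -(ler_pM2l mm0); apply: le_trans cod; rewrite r1E /mu -/a.
  have coef : m * (m + 1) * ((m - 2) * (m^-1 + 2 * eta) + del) <=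
      2 * (m - 1) * (m + 1) * (1 - m^-1 - 2 * eta) - m * (m - 1).
    have e5 : 0 <= eta * ((m + 1) * (2 * m ^+ 2 + 8 * m + 4)).
      have m0 : 0 <= m := le_trans ler01 m1.
      apply: mulr_ge0 (ltW eta0) _; apply: mulr_ge0; first exact: addr_ge0.
      by do !apply: addr_ge0 => //; apply: mulr_ge0 => //; apply: sqr_ge0.
    have e1 : m * m * m * m^-1 = m * m by rewrite -[LHS]mulrA [m / m]mulrC minv mulr1.
    by rewrite mulrC in minv; lra.
  by have := ler_wpM2r a0 coef; lra.
have del0' := ltW del0.
have eta2 : 0 <= eta / 2 by apply: divr_ge0 => //; apply: ltW.
have mu0 : 0 <= mu.
  by apply: mulr_ge0 => //; apply: addr_ge0; [exact: ltW | exact: mulr_ge0 _ (ltW eta0)].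
have dela : 0 <= del * a by apply: mulr_ge0.
have := card_cliques_in esym mu0 dela hmu Hbig => hcl.
apply: (le_trans (y := (del * a) ^+ r)).
  rewrite -exprMn; apply: lerXn2r; rewrite ?nnegrE //.
    by apply: mulr_ge0 => //; apply: mulr_ge0.
  by rewrite -mulrA; apply: ler_wpM2l.
apply: le_trans hcl _.
rewrite ler_nat; apply: subset_leq_card; apply/subsetP=> t; rewrite !inE.
move=> /andP[/allP tH ->]; rewrite andbT; apply/allP=> z /tH.
by rewrite !inE => /andP[/andP[_ ->] /andP[_ ->]].
Qed.
End DenseCliquesMain.

(** * Euclidean geometry and packing *)

Section Euclid.
Variables (R : realType) (d : nat).
Implicit Types x y z : 'rV[R]_d.

Definition dotv x y : R := \sum_(i < d) x 0 i * y 0 i.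

Lemma dotvC x y : dotv x y = dotv y x.
Proof. by apply: eq_bigr => i _; rewrite mulrC. Qed.

Lemma dotvDl x y z : dotv (x + y) z = dotv x z + dotv y z.
Proof. by rewrite -big_split; apply: eq_bigr => i _; rewrite mxE mulrDl. Qed.

Lemma dotvZl a x y : dotv (a *: x) y = a * dotv x y.
Proof. by rewrite mulr_sumr; apply: eq_bigr => i _; rewrite mxE mulrA. Qed.

Lemma dotvNl x y : dotv (- x) y = - dotv x y.
Proof. by rewrite -scaleN1r dotvZl mulN1r. Qed.

Lemma dotvBl x y z : dotv (x - y) z = dotv x z - dotv y z.
Proof. by rewrite dotvDl dotvNl. Qed.

Lemma dotvZr a x y : dotv y (a *: x) = a * dotv y x.
Proof. by rewrite dotvC dotvZl dotvC. Qed.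

Lemma dotvBr x y z : dotv z (x - y) = dotv z x - dotv z y.
Proof. by rewrite dotvC dotvBl !(dotvC z). Qed.

Lemma dotv0l x : dotv 0 x = 0.
Proof. by rewrite -(scale0r x) dotvZl mul0r. Qed.

Lemma dotv_suml (I : finType) (P : pred I) (F : I -> 'rV[R]_d) y :
  dotv (\sum_(i | P i) F i) y = \sum_(i | P i) dotv (F i) y.
Proof.
rewrite /dotv exchange_big /=; apply: eq_bigr => j _.
by rewrite summxE mulr_suml.
Qed.

Lemma dotv_ge0 x : 0 <= dotv x x.
Proof. by apply: sumr_ge0 => i _; rewrite -expr2 sqr_ge0. Qed.

Lemma dotv_eq0 x : dotv x x = 0 -> x = 0.
Proof.
move=> h; apply/rowP=> i; rewrite mxE; apply/eqP; rewrite -sqrf_eq0.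
have ge0 (j : 'I_d) : true -> 0 <= x 0 j * x 0 j by rewrite -expr2 sqr_ge0.
have h0 : x 0 i * x 0 i = 0 by apply: (psumr_eq0P ge0 h).
by rewrite expr2 h0.
Qed.

Lemma eucl_dist_sqr x y : eucl_dist x y ^+ 2 = dotv (x - y) (x - y).
Proof.
rewrite sqr_sqrtr; first by apply: eq_bigr => i _; rewrite !mxE -expr2.
by apply: sumr_ge0 => i _; apply: sqr_ge0.
Qed.

Lemma eucl_distE x y : eucl_dist x y = Num.sqrt (dotv (x - y) (x - y)).
Proof. by rewrite -eucl_dist_sqr sqrtr_sqr ger0_norm // sqrtr_ge0. Qed.

Lemma eucl_dist_ge0 x y : 0 <= eucl_dist x y.
Proof. exact: sqrtr_ge0. Qed.

Lemma eucl_distC x y : eucl_dist x y = eucl_dist y x.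
Proof. by rewrite !eucl_distE -(opprB y x) dotvNl dotvC dotvNl opprK. Qed.

Lemma eucl_dist_eq0 x y : eucl_dist x y = 0 -> x = y.
Proof.
move=> h; apply/eqP; rewrite -subr_eq0; apply/eqP/dotv_eq0.
by rewrite -eucl_dist_sqr h expr0n.
Qed.

Lemma eucl_distxx x : eucl_dist x x = 0.
Proof. by rewrite eucl_distE subrr dotv0l sqrtr0. Qed.

Lemma eucl_dist_gt0 x y : (0 < eucl_dist x y) = (x != y).
Proof.
rewrite lt_def eucl_dist_ge0 andbT; congr (~~ _); apply/eqP/eqP => [|->].
  exact: eucl_dist_eq0.
exact: eucl_distxx.
Qed.

(** The grid of cells is adapted to coordinates, so the Euclidean distance is
    compared with coordinate differences in both directions. *)
Lemma coord_le_eucl_dist x y i : `|x 0 i - y 0 i| <= eucl_dist x y.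
Proof.
rewrite -sqrtr_sqr ler_wsqrtr // (bigD1 i) //= lerDl.
by apply: sumr_ge0 => j _; apply: sqr_ge0.
Qed.

Lemma eucl_dist_le_coord x y (s : R) : 0 <= s ->
  (forall i, `|x 0 i - y 0 i| <= s) -> eucl_dist x y <= d%:R * s.
Proof.
move=> s0 h; rewrite -(@ler_pXn2r _ 2) ?nnegrE ?eucl_dist_ge0 ?mulr_ge0 //.
rewrite eucl_dist_sqr; apply: (@le_trans _ _ (\sum_(i < d) s ^+ 2)).
  apply: ler_sum => i _; rewrite !mxE -expr2 -real_normK ?num_real //.
  by apply: lerXn2r; rewrite ?nnegrE.
rewrite sumr_const card_ord exprMn -[_ *+ d]mulr_natl; apply: ler_wpM2r.
  exact: sqr_ge0.
by rewrite -natrX ler_nat; case: (d) => // k; rewrite leq_pmulr.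
Qed.
End Euclid.

Section Packing.
Import mathcomp.boot.fintype mathcomp.boot.finset.
Variables (R : realType) (d : nat) (V : finType) (z : V -> 'rV[R]_d).

(** Cutting the cube of side [2 * rho] centred at [q] into cells of side
    [2 * rho / M]; a point on the far face gets an extra cell, hence [M + 1]. *)
Lemma grid_pigeonhole (B : {set V}) (q : 'rV[R]_d) (rho : R) (M L : nat) :
  0 < rho -> (0 < M)%N ->
  (forall v, v \in B -> forall i, `|z v 0 i - q 0 i| <= rho) ->
  (forall C : {set V}, C \subset B ->
    {in C &, forall u v, forall i, `|z u 0 i - z v 0 i| <= 2 * rho / M%:R} ->
    (#|C| <= L)%N) ->
  (#|B| <= M.+1 ^ d * L)%N.
Proof.
move=> rho0 M0 hB hC.
have MR : 0 < M%:R :> R by rewrite ltr0n.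
pose y (v : V) (i : 'I_d) : R := (z v 0 i - q 0 i + rho) * (M%:R / (2 * rho)).
pose cell v : {ffun 'I_d -> 'I_M.+1} := [ffun i => inord (Num.truncn (y v i))].
have k0 : 0 < M%:R / (2 * rho) by apply: divr_gt0 => //; lra.
have y0 v i : v \in B -> 0 <= y v i.
  move=> vB; apply: mulr_ge0; last exact: ltW.
  by have := hB v vB i; rewrite ler_norml => /andP[]; lra.
have yM v i : v \in B -> y v i <= M%:R.
  move=> vB; have : z v 0 i - q 0 i + rho <= 2 * rho.
    by have := hB v vB i; rewrite ler_norml => /andP[]; lra.
  move=> /(ler_wpM2r (ltW k0)); rewrite -/(y v i) => /le_trans; apply.
  by rewrite mulrC divfK // gt_eqF //; lra.
have tM v i : v \in B -> (Num.truncn (y v i) < M.+1)%N.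
  move=> vB; rewrite ltnS -(ler_nat R); apply: le_trans (yM v i vB).
  by have /andP[] := truncn_itv (y0 v i vB).
rewrite -sum1_card (partition_big cell xpredT) //=.
apply: (@leq_trans (\sum_(c : {ffun 'I_d -> 'I_M.+1}) L)%N); last first.
  by rewrite sum_nat_const card_ffun !card_ord.
apply: leq_sum => c _.
have -> : (\sum_(v in B | cell v == c) 1 = #|[set v in B | cell v == c]|)%N.
  by rewrite -sum1_card; apply: eq_bigl => v; rewrite inE.
apply: hC; first by apply/subsetP => v; rewrite inE => /andP[].
move=> u v; rewrite !inE => /andP[uB /eqP cu] /andP[vB /eqP cv] i.
have tE : Num.truncn (y u i) = Num.truncn (y v i).
  have := congr1 (fun f : {ffun 'I_d -> 'I_M.+1} => val (f i)) (etrans cu (esym cv)).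
  by rewrite /= !ffunE !inordK // tM.
have /andP[u1 u2] := truncn_itv (y0 u i uB).
have /andP[v1 v2] := truncn_itv (y0 v i vB).
rewrite tE in u1 u2.
have yd : `|y u i - y v i| <= 1.
  by rewrite ler_norml; move: u2 v2; rewrite -natr1; lra.
have -> : z u 0 i - z v 0 i = (y u i - y v i) * (2 * rho / M%:R).
  by rewrite /y; field; rewrite !gt_eqF //; lra.
rewrite normrM [X in _ * X]ger0_norm; last by apply: divr_ge0; lra.
by rewrite -[leRHS]mul1r; apply: ler_wpM2r => //; apply: divr_ge0; lra.
Qed.

Lemma card_separated (B : {set V}) (q : 'rV[R]_d) (rho s : R) (M : nat) :
  0 < rho -> (0 < M)%N -> d%:R * (2 * rho) < s * M%:R ->
  (forall v, v \in B -> forall i, `|z v 0 i - q 0 i| <= rho) ->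
  {in B &, forall u v, u != v -> s <= eucl_dist (z u) (z v)} ->
  (#|B| <= M.+1 ^ d)%N.
Proof.
move=> rho0 M0 hM hB hs; rewrite -[leqRHS]muln1.
have MR : 0 < M%:R :> R by rewrite ltr0n.
apply: (grid_pigeonhole rho0 M0 hB) => C sCB hC.
apply/card_le1_eqP => v u vC uC; apply/eqP; apply: contraT => nuv.
have := hs u v (subsetP sCB u uC) (subsetP sCB v vC) nuv.
have cell0 : 0 <= 2 * rho / M%:R by apply: divr_ge0; lra.
have := eucl_dist_le_coord cell0 (hC u v uC vC).
have : d%:R * (2 * rho / M%:R) < s by rewrite mulrA ltr_pdivrMr.
by lra.
Qed.
End Packing.

(** * Two-distance sets *)

Section TwoDistance.
Import mathcomp.boot.fintype mathcomp.boot.finset.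
Variable R : realType.

Definition two_distance_family (d : nat) (J : finType) (z : J -> 'rV[R]_d)
    (a b : R) : Prop :=
  forall i j, i != j -> eucl_dist (z i) (z j) = a \/ eucl_dist (z i) (z j) = b.

Lemma two_distanceP (d : nat) (S : {fset 'rV[R]_d}) : two_distance S ->
  exists a b : R, [/\ 0 < a, a <= b & two_distance_family (fun v : S => val v) a b].
Proof.
move=> S2.
suff [a [b [a0 b0 h]]] : exists a b : R, [/\ 0 < a, 0 < b &
    two_distance_family (fun v : S => val v) a b].
  have [ab|/ltW ba] := leP a b; first by exists a, b.
  by exists b, a; split=> // i j /h[]; [right|left].
have inD (u v : S) : u != v -> eucl_dist (val u) (val v) \in distances S.
  move=> nuv; apply/imfset2P; exists (val u); first exact: valP.
  exists (val v) => //; rewrite inE; apply/andP; split; first exact: valP.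
  by rewrite eucl_dist_gt0.
have D0 t : t \in distances S -> 0 < t.
  by case/imfset2P => x _ [y]; rewrite inE => /andP[_ h] ->.
have : (size (enum_fset (distances S)) <= 2)%N := S2.
case E : (enum_fset (distances S)) => [|a [|b [|c s]]] // _.
- exists 1, 1; split=> // u v /inD.
  by rewrite -[_ \in _]/(_ \in enum_fset (distances S)) E.
- have a0 : 0 < a by apply: D0; rewrite -[_ \in _]/(_ \in enum_fset (distances S)) E mem_head.
  exists a, a; split=> // u v /inD.
  by rewrite -[_ \in _]/(_ \in enum_fset (distances S)) E inE => /eqP; left.
- have ab0 t : t \in [:: a; b] -> 0 < t by rewrite -E => /D0.
  exists a, b; split; [by rewrite ab0 ?mem_head | by rewrite ab0 // !inE eqxx orbT|].
  move=> u v /inD; rewrite -[_ \in _]/(_ \in enum_fset (distances S)) E !inE.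
  by case/orP=> /eqP; [left|right].
Qed.

(** A cell of diameter less than the larger distance carries only the smaller
    one, so two rounds of packing bound the whole family. *)
Lemma card_two_distance_family (d : nat) (J : finType) (z : J -> 'rV[R]_d) (a b : R) :
  0 < a -> a <= b -> two_distance_family z a b ->
  (#|J| <= (2 * d).+2 ^ d * (2 * d).+2 ^ d)%N.
Proof.
move=> a0 ab h; have b0 : 0 < b := lt_le_trans a0 ab.
have MR : (2 * d).+1%:R = 2 * d%:R + 1 :> R by rewrite -addn1 natrD natrM.
have dR : 0 <= d%:R :> R by rewrite ler0n.
rewrite -cardsT; have [->|[v0 _]] := set_0Vmem [set: J]; first by rewrite cards0.
apply: (grid_pigeonhole (z := z) (q := z v0) b0) => // [v _ i|C _ hC].
  apply: le_trans (coord_le_eucl_dist _ _ _) _.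
  by have [->|/h[->|->]] := eqVneq v v0; rewrite ?eucl_distxx // ltW.
have distC : {in C &, forall u v, u != v -> eucl_dist (z u) (z v) = a}.
  move=> u v uC vC nuv; case: (h u v nuv) => // db; exfalso.
  have cell0 : 0 <= 2 * b / (2 * d).+1%:R by apply: divr_ge0; rewrite ?MR; lra.
  have := eucl_dist_le_coord cell0 (hC u v uC vC).
  rewrite db; apply/negP; rewrite -ltNge mulrA ltr_pdivrMr; last by rewrite MR; lra.
  by rewrite MR; nra.
have [->|[c0 c0C]] := set_0Vmem C; first by rewrite cards0.
apply: (card_separated (z := z) (q := z c0) (s := a) a0) => //.
- by rewrite MR; nra.
- move=> v vC i; apply: le_trans (coord_le_eucl_dist _ _ _) _.
  by have [->|/distC->] := eqVneq v c0; rewrite ?eucl_distxx // ltW.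
by move=> u v uC vC /distC->.
Qed.

Lemma max_two_distanceP (d : nat) :
  is_max_two_distance R d (max_two_distance R d).
Proof.
pose N := ((2 * d).+2 ^ d * (2 * d).+2 ^ d)%N.
have hN (S : {fset 'rV[R]_d}) : two_distance S -> (#|` S| <= N)%N.
  move=> /two_distanceP[a [b [a0 ab h]]].
  by rewrite cardfE; apply: card_two_distance_family h.
pose P k := `[< exists2 S : {fset 'rV[R]_d}, two_distance S & #|` S| = k >].
have P0 : exists k, P k.
  exists 0%N; apply/asboolP; exists fset0; last by rewrite cardfs0.
  rewrite /two_distance (_ : distances fset0 = fset0) ?cardfs0 //.
  apply/eqP; rewrite -fsubset0; apply/fsubsetP=> t.
  by case/imfset2P => x x0; have : x \in (fset0 : {fset 'rV[R]_d}) := x0; rewrite in_fset0.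
have PN k : P k -> (k <= N)%N by move=> /asboolP[S /hN + <-].
have [k Pk kmax] := ex_maxnP P0 PN.
have : is_max_two_distance R d k.
  split; first by move/asboolP: Pk.
  by move=> S S2; apply: kmax; apply/asboolP; exists S.
move=> hk.
exact: (@xgetPex _ 0%N [set k | is_max_two_distance R d k]%classic (ex_intro _ k hk)).
Qed.

Lemma family_le_max (d : nat) (J : finType) (z : J -> 'rV[R]_d) (a b : R) :
  0 < a -> 0 < b -> two_distance_family z a b -> (#|J| <= max_two_distance R d)%N.
Proof.
move=> a0 b0 h; pose S := [fset z j | j in J].
have zinj : injective z.
  move=> i j zij; apply/eqP; apply: contraT => /h; rewrite zij eucl_distxx.
  by case=> E; move: a0 b0; rewrite -E ltxx.
have <- : #|` S| = #|J| by rewrite card_imfset //= -cardE.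
apply: (max_two_distanceP d).2.
apply: leq_trans (_ : #|` [fset a; b]| <= 2)%N; last by rewrite cardfs2; case: eqP.
apply: fsubset_leq_card; apply/fsubsetP=> t.
case/imfset2P => x /imfsetP[i _ ->] [y]; rewrite inE => /andP[/imfsetP[j _ ->] dpos] ->.
have nij : i != j by apply: contraTneq dpos => ->; rewrite eucl_distxx ltxx.
by rewrite in_fset2; case: (h i j nij) => ->; rewrite eqxx ?orbT.
Qed.
End TwoDistance.

Section TwoDistanceBounds.
Import mathcomp.boot.fintype mathcomp.boot.finset.
Variable R : realType.

Lemma dotv_delta (d : nat) (x : 'rV[R]_d) i : dotv x (delta_mx 0 i) = x 0 i.
Proof.
rewrite /dotv (bigD1 i) //= mxE !eqxx mulr1 big1 ?addr0 // => j nji.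
by rewrite mxE (negPf nji) andbF mulr0.
Qed.

Definition householder (d : nat) (v x : 'rV[R]_d) : 'rV[R]_d :=
  x - (2 * dotv x v / dotv v v) *: v.

Lemma householderB (d : nat) (v x y : 'rV[R]_d) :
  householder v (x - y) = householder v x - householder v y.
Proof. by rewrite /householder dotvBl; apply/rowP=> i; rewrite !mxE; ring. Qed.

Lemma householder_isometry (d : nat) (v x : 'rV[R]_d) :
  dotv (householder v x) (householder v x) = dotv x x.
Proof.
have [v0|vn0] := eqVneq (dotv v v) 0.
  by rewrite /householder (dotv_eq0 v0) scaler0 subr0.
by rewrite /householder !dotvBl !dotvBr !dotvZl !dotvZr (dotvC v x); field.
Qed.

(** The reflection exchanging the normal of the hyperplane with a coordinate
    axis moves the family into a coordinate hyperplane. *)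
Lemma hyperplane_family_le_max (d : nat) (J : finType) (z : J -> 'rV[R]_d.+1)
    (a b : R) (U : 'rV[R]_d.+1) :
  0 < a -> 0 < b -> two_distance_family z a b -> U != 0 ->
  (forall i j, dotv (z i - z j) U = 0) -> (#|J| <= max_two_distance R d)%N.
Proof.
move=> a0 b0 hz U0 zU.
have UU : 0 < dotv U U.
  by rewrite lt_def dotv_ge0 andbT; apply: contraNneq U0 => /dotv_eq0->.
pose W := (Num.sqrt (dotv U U))^-1 *: U.
have WW : dotv W W = 1.
  rewrite dotvZl dotvZr mulrA -invfM -expr2 sqr_sqrtr ?ltW // mulVf //.
  by rewrite gt_eqF.
have zW i j : dotv (z i - z j) W = 0 by rewrite dotvZr zU mulr0.
clearbody W; pose v := W - delta_mx 0 0.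
have d00 : (delta_mx 0 0 : 'rV[R]_d.+1) 0 0 = 1 by rewrite mxE !eqxx.
have v00 : v 0 0 = W 0 0 - 1 by rewrite !mxE.
have vv : dotv v v = 2 * (1 - W 0 0).
  rewrite dotvBl !dotvBr WW !dotv_delta (dotvC (delta_mx 0 0) W) dotv_delta d00.
  by ring.
have H0 x : dotv x W = 0 -> householder v x 0 0 = 0.
  move=> xW; have xv : dotv x v = - x 0 0 by rewrite dotvBr xW dotv_delta sub0r.
  have -> : householder v x 0 0 = x 0 0 - 2 * dotv x v / dotv v v * v 0 0.
    by rewrite /householder !mxE.
  rewrite xv v00 vv.
  have [W1|W1] := eqVneq (1 - W 0 0) 0; last by field.
  have v0 : v = 0 by apply: dotv_eq0; rewrite vv W1 mulr0.
  have We : W = delta_mx 0 0 by apply/eqP; rewrite -subr_eq0 -/v v0.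
  by move: xW; rewrite We dotv_delta => ->; rewrite oppr0 mulr0 mul0r mul0r subr0.
pose g j : 'rV[R]_d := \row_i householder v (z j) 0 (lift 0 i).
apply: (@family_le_max R d J g a b a0 b0) => i j nij.
have -> : eucl_dist (g i) (g j) = eucl_dist (z i) (z j); last exact: hz.
rewrite !eucl_distE; congr Num.sqrt; rewrite -(householder_isometry v).
rewrite [RHS]/dotv big_ord_recl (H0 _ (zW i j)) mulr0 add0r.
by apply: eq_bigr => k _; rewrite householderB !mxE.
Qed.

Lemma eucl_dist_eq (d : nat) (x y : 'rV[R]_d) (c : R) :
  dotv (x - y) (x - y) = c -> eucl_dist x y = Num.sqrt c.
Proof. by rewrite eucl_distE => ->. Qed.

(** On the line: three equally spaced points. *)
Lemma max_two_distance1 : (3 <= max_two_distance R 1)%N.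
Proof.
have <- : #|'I_3| = 3%N by rewrite card_ord.
apply: (@family_le_max R 1 'I_3 (fun i => const_mx i%:R) (Num.sqrt 1) (Num.sqrt 4));
  rewrite ?sqrtr_gt0 ?ltr01 ?ltr0n //.
have H (i j : 'I_3) : dotv (const_mx i%:R - const_mx j%:R : 'rV[R]_1)
    (const_mx i%:R - const_mx j%:R) = (i%:R - j%:R) ^+ 2.
  by rewrite /dotv big_ord1 !mxE expr2.
by case=> [[|[|[|]]]] // hi; case=> [[|[|[|]]]] // hj nij; [left|right|left|left|right|left];
  apply: eucl_dist_eq; rewrite H /=; ring.
Qed.

(** In the plane: the vertices of a square. *)
Lemma max_two_distance2 : (4 <= max_two_distance R 2)%N.
Proof.
have <- : #|{: bool * bool}| = 4%N by rewrite card_prod card_bool.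
apply: (@family_le_max R 2 _ (fun p : bool * bool =>
   \row_(k < 2) (if k == 0 then p.1%:R else p.2%:R)) (Num.sqrt 1) (Num.sqrt 2));
  rewrite ?sqrtr_gt0 ?ltr01 ?ltr0n //.
have H (p q : bool * bool) (u := fun p : bool * bool =>
   \row_(k < 2) (if k == 0 then p.1%:R else p.2%:R) : 'rV[R]_2) :
   dotv (u p - u q) (u p - u q) = (p.1%:R - q.1%:R) ^+ 2 + (p.2%:R - q.2%:R) ^+ 2.
  by rewrite /dotv big_ord_recl big_ord1 !mxE /= !expr2.
move=> [[] []] [[] []] // _;
 try (by left; apply: eucl_dist_eq; rewrite H /=; ring);
 by right; apply: eucl_dist_eq; rewrite H /=; ring.
Qed.

(** The midpoints of the edges of a regular simplex: indicator vectors of the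
    pairs in [d + 1] coordinates, which lie in a hyperplane. *)
Lemma bin2_le_max_two_distance (d : nat) : ('C(d.+1, 2) <= max_two_distance R d)%N.
Proof.
pose J := {B : {set 'I_d.+1} | #|B| == 2}.
have -> : 'C(d.+1, 2) = #|{: J}|.
  rewrite -[d.+1 in LHS]card_ord -card_draws card_sig.
  by apply: eq_card => B; rewrite inE.
pose ind (B : {set 'I_d.+1}) : 'rV[R]_d.+1 := \row_i (i \in B)%:R.
have dotI B C : dotv (ind B) (ind C) = #|B :&: C|%:R.
  rewrite -sum1_card natr_sum big_mkcond /=; apply: eq_bigr => i _.
  by rewrite !mxE inE; case: (i \in B); case: (i \in C); rewrite ?mulr1 ?mulr0 ?mul0r.
apply: (@hyperplane_family_le_max d J (fun B => ind (val B)) (Num.sqrt 2) (Num.sqrt 4)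
  (const_mx 1)); rewrite ?sqrtr_gt0 ?ltr0n //.
- move=> [B hB] [C hC]; rewrite -val_eqE /= => nBC.
  have : dotv (ind B - ind C) (ind B - ind C) = 4 - 2 * #|B :&: C|%:R.
    rewrite dotvBl !dotvBr !dotI !setIid (setIC C B) (eqP hB) (eqP hC); ring.
  have : (#|B :&: C| < 2)%N.
    rewrite ltnNge; apply: contra nBC => h; apply/eqP.
    have /eqP <- : B :&: C == B by rewrite eqEcard subsetIl (eqP hB).
    by apply/eqP; rewrite eqEcard subsetIr (eqP hC).
  case: #|B :&: C| => [|[|//]] _ E; [right|left]; apply: eucl_dist_eq; rewrite E; ring.
- by apply/eqP => /rowP/(_ 0); rewrite !mxE => /eqP; rewrite oner_eq0.
move=> [B hB] [C hC] /=.
have dot1 (A : {set 'I_d.+1}) : dotv (ind A) (const_mx 1) = #|A|%:R.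
  rewrite -sum1_card natr_sum big_mkcond /=; apply: eq_bigr => i _.
  by rewrite !mxE mulr1; case: (i \in A).
by rewrite dotvBl !dot1 (eqP hB) (eqP hC) subrr.
Qed.

(** Limits of cliques with two very different scales have at most these
    cardinalities, so they are never larger than genuine two-distance sets. For
    [3 <= d] the midpoints above suffice; the line and the plane need their own
    examples. *)
Lemma max_two_distance_ge (d : nat) : (1 <= d)%N ->
  (d.+2 <= max_two_distance R d)%N /\
  forall a b, (a + b = d.+2)%N -> (a * b <= max_two_distance R d)%N.
Proof.
move=> d1; case: (ltnP d 3) => d3.
  have [-> | ->] : d = 1%N \/ d = 2%N by lia.
    by split=> [|a b ab]; apply: leq_trans max_two_distance1; nia.
  by split=> [|a b ab]; apply: leq_trans max_two_distance2; nia.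
have := bin2_le_max_two_distance d; rewrite bin2 /=.
have : ((d.+1 * d)./2.*2 = d.+1 * d)%N.
  by rewrite halfK oddM /= andNb subn0.
move: (_ ./2) => /= k h le_m; split=> [|a b ab]; apply: leq_trans le_m; first nia.
have amgm : (4 * (a * b) <= d.+2 * d.+2)%N by rewrite -ab mulnn; apply: (nat_AGM2 a b).1.
have [d4|d4] := leqP 4 d; first nia.
have d3' : d = 3%N by lia.
have : (a * b < 7)%N by rewrite d3' in amgm; lia.
by rewrite d3' in h *; lia.
Qed.
End TwoDistanceBounds.

(** * Dimension count for two different scales *)

Section DimensionCount.
Import mathcomp.boot.fintype mathcomp.boot.finset.
Variable R : realType.

Lemma card_le_dim (d : nat) (J : finType) (S : {set J}) (e : J -> 'rV[R]_d) :
  (forall lam : J -> R, \sum_(j in S) lam j *: e j = 0 ->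
     {in S, forall j, lam j = 0}) -> (#|S| <= d)%N.
Proof.
move=> indep; pose M : 'M[R]_(#|S|, d) := \matrix_k e (enum_val k).
suff : row_free M by move=> /eqP <-; apply: rank_leq_col.
rewrite -kermx_eq0; apply/eqP/row_matrixP => k0; rewrite row0.
set v := row k0 _.
have vM : v *m M = 0 by apply/sub_kermxP; apply: row_sub.
pose lam j := \sum_(k | enum_val k == j) v 0 k.
have lamE k : lam (enum_val k) = v 0 k.
  by rewrite /lam (big_pred1 k) // => l; rewrite (inj_eq enum_val_inj).
apply/rowP=> k; rewrite [RHS]mxE -lamE; apply: indep; last exact: enum_valP.
rewrite big_enum_val /= -[RHS]vM; apply/rowP=> i; rewrite summxE [RHS]mxE.
by apply: eq_bigr => l _; rewrite mxE lamE [M _ _]mxE.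
Qed.

(** A unit vector and the edge vectors of two regular simplices from one of
    their vertices, in three mutually orthogonal spaces, are independent. *)
Lemma simplices_dim (d : nat) (J : finType) (i : J) (A B : {set J}) (e : J -> 'rV[R]_d) :
  i \notin A -> i \notin B -> A :&: B = set0 ->
  dotv (e i) (e i) = 1 ->
  (forall j, j \in A :|: B -> dotv (e i) (e j) = 0) ->
  {in A &, forall j l, dotv (e j) (e l) = if j == l then 1 else 2^-1} ->
  {in B &, forall j l, dotv (e j) (e l) = if j == l then 1 else 2^-1} ->
  (forall j l, j \in A -> l \in B -> dotv (e j) (e l) = 0) ->
  (#|A| + #|B| < d)%N.
Proof.
move=> iA iB dAB eii eij eA eB eAB; have iAB : i \notin A :|: B by rewrite inE negb_or iA.
have cAB : #|A :|: B| = (#|A| + #|B|)%N.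
  by rewrite cardsU dAB cards0 subn0.
suff : (#|i |: (A :|: B)| <= d)%N by rewrite cardsU1 iAB cAB add1n.
apply: (card_le_dim (e := e)) => lam.
rewrite big_setU1 //= (big_setID A) /=.
have -> : (A :|: B) :&: A = A by apply/setP=> j; rewrite !inE; case: (j \in A); rewrite ?andbF.
have -> : (A :|: B) :\: A = B.
  apply/setP=> j; rewrite !inE; have /setP/(_ j) := dAB; rewrite !inE.
  by case: (j \in A); case: (j \in B).
move=> lam0.
have sum_dot (C : {set J}) l : dotv (\sum_(j in C) lam j *: e j) (e l) =
    \sum_(j in C) lam j * dotv (e j) (e l).
  by rewrite dotv_suml; apply: eq_bigr => j _; rewrite dotvZl.
have lam0l l : lam i * dotv (e i) (e l) + (\sum_(j in A) lam j * dotv (e j) (e l) +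
    \sum_(j in B) lam j * dotv (e j) (e l)) = 0.
  by rewrite -!sum_dot -dotvZl -!dotvDl lam0 dotv0l.
have lami : lam i = 0.
  have := lam0l i; rewrite eii mulr1 !big1 ?addr0 // => j jC;
    by rewrite dotvC eij ?mulr0 // inE jC ?orbT.
have simplex (C : {set J}) :
    {in C &, forall j l, dotv (e j) (e l) = if j == l then 1 else 2^-1} ->
    {in C, forall l, \sum_(j in C) lam j * dotv (e j) (e l) = 0} ->
    {in C, forall l, lam l = 0}.
  move=> eC sC; set s := \sum_(j in C) lam j.
  have lamE l : l \in C -> lam l = - s.
    move=> lC; have := sC l lC; rewrite (bigD1 l) //= eC // eqxx mulr1.
    rewrite (eq_bigr (fun j => lam j * 2^-1)) => [|j /andP[jC jl]]; last first.
      by rewrite eC // (negPf jl).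
    rewrite -mulr_suml => h.
    have : s = lam l + \sum_(i in C | i != l) lam i by rewrite /s (bigD1 l).
    by lra.
  have s0 : s * (1 + #|C|%:R) = 0.
    have : s = - s * #|C|%:R by rewrite {1}/s (eq_bigr (fun=> - s)) // sumr_const mulr_natr.
    by lra.
  move/eqP: s0; rewrite mulf_eq0 => /orP[/eqP s0 l lC|].
    by rewrite lamE // s0 oppr0.
  by rewrite gt_eqF // ltr_wpDr.
have lamA : {in A, forall l, lam l = 0}.
  apply: simplex eA _ => l lA; have := lam0l l.
  rewrite lami mul0r add0r [X in _ + X]big1 ?addr0 // => j jB.
  by rewrite dotvC eAB // mulr0.
have lamB : {in B, forall l, lam l = 0}.
  apply: simplex eB _ => l lB; have := lam0l l.
  by rewrite lami mul0r add0r big1 ?add0r // => j jA; rewrite eAB // mulr0.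
by move=> j; rewrite !inE => /orP[/eqP->|/orP[/lamA|/lamB]].
Qed.

Definition fiber_of (J : finType) (T : eqType) (Y : J -> T) (i : J) : {set J} :=
  [set j | Y j == Y i].

Definition rep (J : finType) (T : eqType) (Y : J -> T) (i : J) : J :=
  odflt i [pick l | Y l == Y i].

Definition reps (J : finType) (T : eqType) (Y : J -> T) : {set J} :=
  [set i | rep Y i == i].

Section Clusters.
Variables (J : finType) (T : eqType) (Y : J -> T).

Lemma repP i : Y (rep Y i) = Y i.
Proof. by rewrite /rep; case: pickP => [l /eqP|]. Qed.

Lemma rep_eq i j : Y i = Y j -> rep Y i = rep Y j.
Proof.
rewrite /rep => ->; case: pickP => [//|/(_ j)].
by rewrite eqxx.
Qed.

Lemma rep_in i : rep Y i \in reps Y.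
Proof. by rewrite inE; apply/eqP/rep_eq/repP. Qed.

Lemma reps_inj : {in reps Y &, injective Y}.
Proof. by move=> i j; rewrite !inE => /eqP {2}<- /eqP {2}<-; apply: rep_eq. Qed.

Lemma reps_fiber i : reps Y :&: fiber_of Y i = [set rep Y i].
Proof.
apply/setP=> j; rewrite in_setI in_set1 [_ \in fiber_of _ _]inE.
apply/andP/eqP => [[jr /eqP Yj]|->]; last by rewrite rep_in repP.
by apply: reps_inj => //; rewrite ?rep_in ?repP.
Qed.

Lemma sum_clusters : (\sum_(i in reps Y) #|fiber_of Y i| = #|J|)%N.
Proof.
rewrite -[RHS]sum1_card [RHS](partition_big (rep Y) (mem (reps Y))) /=; last first.
  by move=> i _; apply: rep_in.
apply: eq_bigr => i iR; rewrite -sum1_card; apply: eq_bigl => j.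
rewrite inE; apply/eqP/eqP => [Yj|<-]; last by rewrite repP.
by rewrite (rep_eq Yj); apply/eqP; move: iR; rewrite inE.
Qed.

(** With [a] clusters, those containing a free index have at most [d - a]
    elements and the others at most two, so the product [a * (d - a)] bounds the
    total, unless [d - a = 1]: then only the two indices that are not free may
    share a cluster, and the total is at most [a + 1]. *)
Lemma card_clusters (free : {set J}) (d : nat) :
  (#|~: free| <= 2)%N -> free != set0 ->
  {in free, forall i, (#|reps Y| + #|fiber_of Y i| <= d)%N} ->
  (#|J| <= d)%N \/ exists a b, (a + b = d)%N /\ (#|J| <= a * b)%N.
Proof.
move=> c2 /set0Pn[i0 i0F] hd.
have self i : i \in fiber_of Y i by rewrite inE.
have c_gt0 i : (0 < #|fiber_of Y i|)%N by apply/card_gt0P; exists i.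
set a := #|reps Y| in hd *.
have [b2|b1] := leqP 2 (d - a).
  right; exists a, (d - a)%N; split; first by have := hd i0 i0F; lia.
  rewrite -sum_clusters -sum_nat_const; apply: leq_sum => i iR.
  have [j /setIP[jF jC]|dis] := pickP (fun j => j \in free :&: fiber_of Y i).
    have := hd j jF; have -> : fiber_of Y j = fiber_of Y i; last by lia.
    by apply/setP=> k; move: jC; rewrite !inE => /eqP->.
  apply: leq_trans b2; apply: leq_trans c2; apply: subset_leq_card.
  apply/subsetP=> j jC; rewrite inE; apply/negP => jF.
  by have := dis j; rewrite inE jF jC.
left; have dE : d = a.+1 by have := hd i0 i0F; have := c_gt0 i0; lia.
have single i j : i \in free -> Y j = Y i -> j = i.
  move=> iF Yji; have : (#|fiber_of Y i| <= 1)%N by have := hd i iF; lia.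
  move/card_le1_eqP; apply; rewrite // inE; exact/eqP.
have inj_card (D : {set J}) : {in D &, injective Y} -> (#|D| <= a)%N.
  move=> injD; rewrite -(@card_in_imset _ _ (rep Y)) => [|x y xD yD /(congr1 Y)].
    by apply: subset_leq_card; apply/subsetP=> _ /imsetP[x _ ->]; apply: rep_in.
  by rewrite !repP; apply: injD.
have injF : {in free &, injective Y} by move=> x y xF yF /esym /(single x y xF)->.
rewrite dE -(cardsC free).
have [C0|[k kC]] := set_0Vmem (~: free); first by rewrite C0 cards0; have := inj_card _ injF; lia.
have kF : k \notin free by rewrite inE in kC.
have : (#|k |: free| <= a)%N.
  apply: inj_card => x y; rewrite !inE => /orP[/eqP->|xF] /orP[/eqP->|yF] //.
  - by move=> /(single y k yF) E; rewrite E yF in kF.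
  - by move=> /esym /(single x k xF) E; rewrite E xF in kF.
  exact: injF.
by rewrite cardsU1 kF; lia.
Qed.
End Clusters.
End DimensionCount.

(** * Limits along an ultrafilter *)

Section UltraLimits.
Import numFieldNormedType.Exports.
Variables (R : realType) (F : set_system nat).
Hypothesis FF : UltraFilter F.
Hypothesis Foo : forall A : set nat, (\oo A)%classic -> F A.

(** Compactness gives a cluster point, and an ultrafilter converges to each of
    its cluster points; so no subsequences have to be extracted. *)
Lemma ultra_cvg (u : nat -> R) (B : R) : F [set k | `|u k| <= B]%classic ->
  exists l : R, (u x @[x --> F] --> l)%classic.
Proof.
move=> uB; have PF : ProperFilter F := @ultra_proper _ F FF.
have : compact `[(- B), B]%classic by apply: segment_compact.
have Fu : (u x @[x --> F])%classic `[(- B), B]%classic.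
  change (F (u @^-1` `[(- B), B])%classic).
  by move: uB; apply: filterS => k /=; rewrite ler_norml in_itv.
move=> /(_ _ _ Fu)[l [_ ul]]; exists l => N Nl.
have [//|nN] := in_ultra_setVsetC (u @^-1` N)%classic FF.
by have [x [/= nNx Nx]] := ul (~` N)%classic N nN Nl.
Qed.

Lemma ultra_eps (C : R) : ((C / k.+1%:R) @[k --> F] --> (0 : R))%classic.
Proof.
have h : ((C / k.+1%:R) @[k --> \oo] --> (0 : R))%classic.
  rewrite -[X in (_ --> X)%classic](mulr0 C); apply: cvgMl_tmp => /=.
  exact: cvg_harmonic.
by move=> N /h; apply: Foo.
Qed.

Lemma ultra_squeeze0 (u : nat -> R) (C : R) :
  F [set k | `|u k| <= C / k.+1%:R]%classic -> (u x @[x --> F] --> (0 : R))%classic.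
Proof.
move=> h; have PF : ProperFilter F := @ultra_proper _ F FF.
apply: (@squeeze_cvgr _ _ _ _ (fun k => - (C / k.+1%:R)) (fun k => C / k.+1%:R)).
- by move: h; apply: filterS => k /=; rewrite ler_norml.
- by rewrite -oppr0; apply: cvgN; apply: ultra_eps.
- exact: ultra_eps.
Qed.

Lemma ultra_unique (u : nat -> R) (l l' : R) :
  (u x @[x --> F] --> l)%classic -> (u x @[x --> F] --> l')%classic -> l = l'.
Proof.
have PF : ProperFilter F := @ultra_proper _ F FF.
by move=> h h'; apply: cvg_unique h h'.
Qed.

Definition vcvg (d : nat) (x : nat -> 'rV[R]_d) (l : 'rV[R]_d) : Prop :=
  forall i, (x k 0 i @[k --> F] --> l 0 i)%classic.

Lemma vcvg_exists (d : nat) (x : nat -> 'rV[R]_d) (B : R) :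
  F [set k | forall i, `|x k 0 i| <= B]%classic -> exists l, vcvg x l.
Proof.
move=> xB; have PF : ProperFilter F := @ultra_proper _ F FF.
have h i : exists l : R, (x k 0 i @[k --> F] --> l)%classic.
  by apply: (@ultra_cvg _ B); move: xB; apply: filterS => k /= /(_ i).
have [l hl] := boolp.choice h.
by exists (\row_i l i) => i; rewrite mxE.
Qed.

Lemma vcvgB (d : nat) (x y : nat -> 'rV[R]_d) l m :
  vcvg x l -> vcvg y m -> vcvg (fun k => x k - y k) (l - m).
Proof.
move=> hx hy i; have PF : ProperFilter F := @ultra_proper _ F FF.
rewrite !mxE; under eq_fun do rewrite !mxE.
by apply: cvgB.
Qed.

Lemma dotv_cvg (d : nat) (x y : nat -> 'rV[R]_d) l m :
  vcvg x l -> vcvg y m -> (dotv (x k) (y k) @[k --> F] --> dotv l m)%classic.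
Proof.
move=> hx hy; have PF : ProperFilter F := @ultra_proper _ F FF.
rewrite /dotv; elim: (index_enum _) => [|i s IH].
  by rewrite big_nil; under eq_fun do rewrite big_nil; apply: cvg_cst.
rewrite big_cons; under eq_fun do rewrite big_cons.
by apply: cvgD => //; apply: cvgM.
Qed.

Lemma ultra_color (col : nat -> bool) :
  F [set k | col k = `[< F [set k | col k]%classic >]]%classic.
Proof.
have PF : ProperFilter F := @ultra_proper _ F FF.
have [h|h] := in_ultra_setVsetC [set k | col k]%classic FF.
  by move: (h); apply: filterS => k /= ->; apply/esym/asboolP; exact: h.
move: (h); apply: filterS => k /= /negP/negPf ->; apply/esym/negbTE/asboolPn => h'.
apply: (@filter_not_empty _ F PF); rewrite -(setICl [set k | col k]%classic).
exact: filterI h h'.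
Qed.
End UltraLimits.

Lemma exists_ultrafilter : exists F : set_system nat, UltraFilter F /\
  forall A : set nat, (\oo A)%classic -> F A.
Proof.
have [G [UG sG]] := @ultraFilterLemma nat (\oo)%classic _.
by exists G; split=> // A /sG.
Qed.

(** * Cliques of nearly equal distances *)

(** Points [c_z] whose mutual distances lie in one of the intervals of length
    [c_w] from [c_t1] and [c_t2], together with alternative positions [c_z'] of
    some of them; [c_col i j] tells which interval is used, [true] standing for
    the shorter distance. *)
Record config (R : realType) (d : nat) (J : finType) := Config {
  c_t1 : R; c_t2 : R; c_w : R;
  c_z : J -> 'rV[R]_d; c_z' : J -> 'rV[R]_d;
  c_col : J -> J -> bool }.

Section Geometry.
Import mathcomp.boot.fintype mathcomp.boot.finset.
Variables (R : realType).

Definition scale (d : nat) (J : finType) (c : config R d J) (b : bool) : R :=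
  if b then c_t1 c else c_t2 c.

Definition in_interval (T w x : R) : Prop := T <= x <= T + w.

Record is_config (d : nat) (J : finType) (free : {set J}) (K : R)
    (c : config R d J) : Prop := IsConfig {
  cf_t1 : 0 < c_t1 c;
  cf_t12 : c_t1 c <= c_t2 c;
  cf_w : 0 < c_w c;
  cf_dist : forall i j, i != j ->
    in_interval (scale c (c_col c i j)) (c_w c) (eucl_dist (c_z c i) (c_z c j));
  cf_dist' : forall i j, i \in free -> i != j ->
    in_interval (scale c (c_col c i j)) (c_w c) (eucl_dist (c_z' c i) (c_z c j));
  cf_far : forall i, i \in free -> K * c_w c <= eucl_dist (c_z' c i) (c_z c i);
  cf_near : forall i j, i \in free -> i != j ->
    K * eucl_dist (c_z' c i) (c_z c i) <= scale c (c_col c i j) }.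

(** A point [y] nearly equidistant from [x] and [x'] is near their bisector; the
    offset of the bisector from [x] accounts for the quadratic error term. *)
Lemma orth_estimate (d : nat) (x x' y : 'rV[R]_d) (T w : R) : 0 <= w -> 0 <= T ->
  in_interval T w (eucl_dist x y) -> in_interval T w (eucl_dist x' y) ->
  `|2 * dotv (x' - x) (y - x)| <= w * (2 * T + w) + eucl_dist x' x ^+ 2.
Proof.
move=> w0 T0 /andP[h1 h2] /andP[h3 h4].
have sq (u : R) : T <= u -> u <= T + w -> T ^+ 2 <= u ^+ 2 <= (T + w) ^+ 2.
  by move=> u1 u2; apply/andP; split; apply: lerXn2r; rewrite ?nnegrE; lra.
have /andP[a1 a2] := sq _ h1 h2; have /andP[b1 b2] := sq _ h3 h4.
have E : eucl_dist x' y ^+ 2 = eucl_dist x' x ^+ 2 - 2 * dotv (x' - x) (y - x)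
    + eucl_dist x y ^+ 2.
  rewrite (eucl_distC x y) !eucl_dist_sqr (_ : x' - y = (x' - x) - (y - x)); last first.
    by rewrite opprB addrA subrK.
  move: (x' - x) (y - x) => a b; rewrite dotvBl !dotvBr (dotvC b a); ring.
have TW : (T + w) ^+ 2 = T ^+ 2 + w * (2 * T + w) by ring.
rewrite ler_norml; rewrite TW in a2 b2; have := sqr_ge0 (eucl_dist x' x).
by lra.
Qed.

Lemma norm_dotvZ (d : nat) (x y : 'rV[R]_d) (a b B : R) : 0 < a -> 0 < b ->
  `|2 * dotv x y| <= 2 * (a * b * B) -> `|dotv (a^-1 *: x) (b^-1 *: y)| <= B.
Proof.
move=> a0 b0; rewrite normrM ger0_norm // => h.
rewrite dotvZl dotvZr mulrA normrM [X in X * _]ger0_norm; last first.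
  by apply: mulr_ge0; rewrite invr_ge0 ltW.
rewrite -invfM mulrC ler_pdivrMr ?mulr_gt0 //; lra.
Qed.

(** Relative to [s], the width [w] is at most [1 / K]; relative to [T], so is
    [s]. These are the two errors in the orthogonality estimate. *)
Lemma partner_estimate (d : nat) (x x' y : 'rV[R]_d) (T t w K : R) :
  1 <= K -> 0 < w -> T <= t ->
  in_interval T w (eucl_dist x y) -> in_interval T w (eucl_dist x' y) ->
  K * w <= eucl_dist x' x -> K * eucl_dist x' x <= T ->
  `|dotv ((eucl_dist x' x)^-1 *: (x' - x)) (t^-1 *: (y - x))| <= 2 / K.
Proof.
move=> K1 w0 Tt hx hx' far near; set s := eucl_dist x' x in far near *.
have s0 : 0 < s by nra.
have sT : s <= T by nra.
have T0 : 0 < T by lra.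
apply: norm_dotvZ => //; first lra.
apply: (le_trans (orth_estimate (ltW w0) (ltW T0) hx hx')); rewrite -/s.
have wK : w <= s / K by rewrite ler_pdivlMr; lra.
have sK : s <= T / K by rewrite ler_pdivlMr; lra.
have : w * (2 * T + w) <= (s / K) * (3 * T) by apply: ler_pM => //; nra.
have : s ^+ 2 <= s * (T / K) by rewrite expr2; apply: ler_wpM2l; lra.
have : s * T * (2 / K) <= s * t * (2 / K).
  by apply: ler_wpM2r; [apply: divr_ge0; lra | apply: ler_wpM2l; lra].
by rewrite !mulrA; lra.
Qed.

(** Moving along a short edge changes the long distance by at most [w], so short
    and long edges are nearly orthogonal. *)
Lemma cross_estimate (d : nat) (x x' y : 'rV[R]_d) (t1 t2 w : R) :
  0 < t1 -> 0 < w -> w <= t1 -> t1 <= t2 ->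
  in_interval t1 w (eucl_dist x' x) ->
  in_interval t2 w (eucl_dist x y) -> in_interval t2 w (eucl_dist x' y) ->
  `|dotv (t1^-1 *: (x' - x)) (t2^-1 *: (y - x))| <= 2 * (w / t1) + 2 * (t1 / t2).
Proof.
move=> t10 w0 wt t12 /andP[s1 s2] hx hx'.
have t20 : 0 < t2 by lra.
apply: norm_dotvZ => //; apply: (le_trans (orth_estimate _ _ hx hx')); try lra.
have : eucl_dist x' x ^+ 2 <= 4 * t1 ^+ 2.
  have -> : 4 * t1 ^+ 2 = (2 * t1) ^+ 2 by ring.
  by apply: lerXn2r; rewrite ?nnegrE; lra.
have -> : 2 * (t1 * t2 * (2 * (w / t1) + 2 * (t1 / t2))) =
   4 * (w * t2) + 4 * t1 ^+ 2 by field; rewrite !gt_eqF.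
have : w * (2 * t2 + w) <= w * (4 * t2) by apply: ler_wpM2l; lra.
by lra.
Qed.

Lemma unit_scaled (d : nat) (x y : 'rV[R]_d) (t : R) :
  dotv (t^-1 *: (x - y)) (t^-1 *: (x - y)) = (eucl_dist x y / t) ^+ 2.
Proof. by rewrite dotvZl dotvZr -eucl_dist_sqr exprMn mulrA -expr2 mulrC. Qed.

Lemma scaled_coord_le (d : nat) (x y : 'rV[R]_d) (t B : R) i : 0 < t ->
  eucl_dist x y <= B * t -> `|(t^-1 *: (x - y)) 0 i| <= B.
Proof.
move=> t0 h; rewrite !mxE normrM ger0_norm ?invr_ge0 ?(ltW t0) //.
rewrite mulrC ler_pdivrMr //; apply: le_trans h.
exact: coord_le_eucl_dist.
Qed.
End Geometry.

Section LimitConfiguration.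
Import numFieldNormedType.Exports.
Import mathcomp.boot.fintype mathcomp.boot.finset.
Variables (R : realType) (d : nat) (J : finType) (free : {set J}).
Variables (F : set_system nat) (c : nat -> config R d J) (i0 : J).
Hypothesis FF : UltraFilter F.
Hypothesis Foo : forall A : set nat, (\oo A)%classic -> F A.
Hypothesis hc : forall k, is_config free k.+1%:R (c k).
Hypothesis i0F : i0 \in free.
Hypothesis J2 : exists j : J, i0 != j.

Let PF : ProperFilter F. Proof. exact: @ultra_proper _ F FF. Qed.

(** The finite choice of an interval is settled by the ultrafilter. *)
Definition lim_col (i j : J) : bool := `[< F [set k | c_col (c k) i j]%classic >].

Lemma lim_colP i j : F [set k | c_col (c k) i j = lim_col i j]%classic.
Proof. exact: (ultra_color FF (fun k => c_col (c k) i j)). Qed.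

Lemma t2_gt0 k : 0 < c_t2 (c k).
Proof. by apply: lt_le_trans (cf_t1 (hc k)) (cf_t12 (hc k)). Qed.

Lemma scale_le k b : scale (c k) b <= c_t2 (c k).
Proof. by case: b => //=; apply: cf_t12 (hc k). Qed.

Lemma width_le k i j : i \in free -> i != j ->
  k.+1%:R * c_w (c k) <= scale (c k) (c_col (c k) i j).
Proof.
move=> iF nij; apply: le_trans (cf_near (hc k) iF nij).
apply: ler_wpM2l => //; apply: le_trans (cf_far (hc k) iF).
by rewrite ler_peMl ?ler1n // ltW // (cf_w (hc k)).
Qed.

Lemma width_le_t2 k : k.+1%:R * c_w (c k) <= c_t2 (c k).
Proof. by have [j nj] := J2; apply: le_trans (width_le k i0F nj) (scale_le _ _). Qed.

Lemma width_t2_cvg0 : (c_w (c k) / c_t2 (c k) @[k --> F] --> (0 : R))%classic.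
Proof.
apply: (ultra_squeeze0 FF Foo (C := 1)); apply: filterE => k /=.
have w0 := cf_w (hc k); have t0 := t2_gt0 k.
rewrite ger0_norm; last by apply: divr_ge0; apply: ltW.
rewrite ler_pdivrMr // mulrAC ler_pdivlMr ?ltr0n // mul1r mulrC.
exact: width_le_t2.
Qed.

Lemma width_t1_cvg0 i j : i \in free -> i != j -> lim_col i j ->
  (c_w (c k) / c_t1 (c k) @[k --> F] --> (0 : R))%classic.
Proof.
move=> iF nij colij; apply: (ultra_squeeze0 FF Foo (C := 1)).
move: (lim_colP i j); apply: filterS => k /= E.
have w0 := cf_w (hc k); have t0 := cf_t1 (hc k).
rewrite ger0_norm; last by apply: divr_ge0; apply: ltW.
rewrite ler_pdivrMr // mulrAC ler_pdivlMr ?ltr0n // mul1r mulrC.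
by have := width_le k iF nij; rewrite E colij.
Qed.

Lemma dist_ratio_cvg (i j : J) (t : nat -> R) (r : R) : i != j ->
  (forall k, 0 < t k) ->
  (scale (c k) (lim_col i j) / t k @[k --> F] --> r)%classic ->
  (c_w (c k) / t k @[k --> F] --> (0 : R))%classic ->
  (eucl_dist (c_z (c k) i) (c_z (c k) j) / t k @[k --> F] --> r)%classic.
Proof.
move=> nij t0 hr hw.
apply: (@squeeze_cvgr _ _ _ _ (fun k => scale (c k) (lim_col i j) / t k)
   (fun k => scale (c k) (lim_col i j) / t k + c_w (c k) / t k)) => //.
  move: (lim_colP i j); apply: filterS => k E.
  have /andP[h1 h2] := cf_dist (hc k) nij; rewrite E in h1 h2.
  have ti : 0 <= (t k)^-1 by rewrite invr_ge0 ltW.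
  by apply/andP; split; rewrite -?mulrDl; apply: ler_wpM2r.
by rewrite -[X in (_ --> X)%classic]addr0; apply: cvgD.
Qed.

Definition rel_pos (t : nat -> R) (i j : J) (k : nat) : 'rV[R]_d :=
  (t k)^-1 *: (c_z (c k) j - c_z (c k) i).

Lemma rel_pos_sub t i j l k : rel_pos t i j k - rel_pos t i l k = rel_pos t l j k.
Proof. by rewrite -scalerBr opprB addrA subrK. Qed.

Lemma rel_pos_dist (t : nat -> R) (h i j : J) (r : R) (Yi Yj : 'rV[R]_d) :
  vcvg F (rel_pos t h i) Yi -> vcvg F (rel_pos t h j) Yj ->
  (eucl_dist (c_z (c k) i) (c_z (c k) j) / t k @[k --> F] --> r)%classic ->
  dotv (Yi - Yj) (Yi - Yj) = r ^+ 2.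
Proof.
move=> hi hj hr; have hd : vcvg F _ (Yi - Yj) := vcvgB FF hi hj.
apply: (ultra_unique FF (dotv_cvg FF hd hd)).
under eq_fun do rewrite rel_pos_sub /rel_pos unit_scaled expr2.
by rewrite expr2; apply: cvgM.
Qed.

Lemma rel_pos_cvg (t : nat -> R) (h i : J) :
  (forall k, 0 < t k) ->
  F [set k | i = h \/ scale (c k) (c_col (c k) i h) <= t k /\ c_w (c k) <= t k]%classic ->
  exists Y, vcvg F (rel_pos t h i) Y.
Proof.
move=> t0 ht; apply: (vcvg_exists FF (B := 2)).
move: ht; apply: filterS => k /= ht j; apply: scaled_coord_le => //.
have [->|nih] := eqVneq i h; first by rewrite eucl_distxx; have := t0 k; lra.
case: ht => [ih|[h1 h2]]; first by rewrite ih eqxx in nih.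
by have /andP[_] := cf_dist (hc k) nih; lra.
Qed.

(** [U] is the limit direction from the free point [i] to its alternative
    position. That position is close to [i] relative to every scale [t] on which
    [j] is at a bounded distance, so [U] is orthogonal to all relative positions. *)
Lemma free_direction (i : J) : i \in free -> exists U : 'rV[R]_d, dotv U U = 1 /\
  forall (t : nat -> R) (j : J) (Y : 'rV[R]_d), i != j -> (forall k, 0 < t k) ->
    F [set k | scale (c k) (c_col (c k) i j) <= t k]%classic ->
    vcvg F (rel_pos t i j) Y -> dotv U Y = 0.
Proof.
move=> iF; pose s k := eucl_dist (c_z' (c k) i) (c_z (c k) i).
have s0 k : 0 < s k.
  apply: lt_le_trans (cf_far (hc k) iF); apply: mulr_gt0; rewrite ?ltr0n //.
  exact: cf_w (hc k).
pose u k := (s k)^-1 *: (c_z' (c k) i - c_z (c k) i).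
have [U hU] : exists U, vcvg F u U.
  apply: (vcvg_exists FF (B := 1)); apply: filterE => k j.
  by apply: scaled_coord_le => //; rewrite mul1r.
exists U; split.
  apply: (ultra_unique FF (dotv_cvg FF hU hU)).
  have -> : (fun k => dotv (u k) (u k)) = (fun=> 1).
    by apply/funext => k; rewrite /u unit_scaled -/(s k) divff ?expr1n // gt_eqF.
  exact: cvg_cst.
move=> t j Y nij t0 ht hY; apply: (ultra_unique FF (dotv_cvg FF hU hY)).
apply: (ultra_squeeze0 FF Foo (C := 2)); move: ht; apply: filterS => k ht.
apply: (partner_estimate (T := scale (c k) (c_col (c k) i j)) (w := c_w (c k))) => //.
- by rewrite ler1n.
- exact: cf_w (hc k).
- exact: cf_dist (hc k) _ _ nij.
- exact: cf_dist' (hc k) _ _ iF nij.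
- exact: cf_far (hc k) _ iF.
- exact: cf_near (hc k) _ _ iF nij.
Qed.

Lemma t1_le_t2_ratio : exists2 rho : R, 0 <= rho &
  (c_t1 (c k) / c_t2 (c k) @[k --> F] --> rho)%classic.
Proof.
have rb k : 0 <= c_t1 (c k) / c_t2 (c k) <= 1.
  have t0 := t2_gt0 k; apply/andP; split.
    by apply: divr_ge0; apply: ltW => //; apply: cf_t1 (hc k).
  by rewrite ler_pdivrMr // mul1r (cf_t12 (hc k)).
have [|rho hr] := @ultra_cvg _ _ FF (fun k => c_t1 (c k) / c_t2 (c k)) 1.
  by apply: filterE => k /=; have /andP[h1 h2] := rb k; rewrite ger0_norm.
exists rho => //; apply: (cvgr_to_ge hr); apply: filterE => k.
by have /andP[] := rb k.
Qed.
End LimitConfiguration.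

Section LimitBound.
Import numFieldNormedType.Exports.
Import mathcomp.boot.fintype mathcomp.boot.finset.
Variables (R : realType) (d : nat) (J : finType) (free : {set J}).
Variables (F : set_system nat) (c : nat -> config R d.+1 J) (i0 : J).
Hypothesis FF : UltraFilter F.
Hypothesis Foo : forall A : set nat, (\oo A)%classic -> F A.
Hypothesis hc : forall k, is_config free k.+1%:R (c k).
Hypothesis i0F : i0 \in free.
Hypothesis J2 : exists j : J, i0 != j.

Let PF : ProperFilter F. Proof. exact: @ultra_proper _ F FF. Qed.

Let t1 k := c_t1 (c k).
Let t2 k := c_t2 (c k).
Let t10 k : 0 < t1 k. Proof. exact: cf_t1 (hc k). Qed.
Let t20 k : 0 < t2 k. Proof. exact: t2_gt0 hc k. Qed.

Lemma rel_pos_self (t : nat -> R) (i : J) : vcvg F (rel_pos c t i i) 0.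
Proof.
move=> j; rewrite /rel_pos; under eq_fun do rewrite subrr scaler0.
exact: cvg_cst.
Qed.

Lemma scale_t2_cvg (rho : R) (b : bool) :
  (t1 k / t2 k @[k --> F] --> rho)%classic ->
  (scale (c k) b / t2 k @[k --> F] --> (if b then rho else 1))%classic.
Proof.
case: b => // _; rewrite /scale /=.
by under eq_fun do rewrite divff ?gt_eqF ?t20 //; apply: cvg_cst.
Qed.

Lemma limit_positions : exists Y : J -> 'rV[R]_d.+1,
  forall j, vcvg F (rel_pos c t2 i0 j) (Y j).
Proof.
suff hj j : exists Y, vcvg F (rel_pos c t2 i0 j) Y.
  by have [Y hY] := boolp.choice hj; exists Y.
apply: (rel_pos_cvg FF hc t20); apply: filterE => k; right; split.
  exact: scale_le hc k _.
apply: le_trans (width_le_t2 hc i0F J2 k).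
by rewrite ler_peMl ?ler1n // ltW // (cf_w (hc k)).
Qed.

Section Positions.
Variables (rho : R) (Y : J -> 'rV[R]_d.+1).
Hypothesis hrho : (t1 k / t2 k @[k --> F] --> rho)%classic.
Hypothesis hY : forall j, vcvg F (rel_pos c t2 i0 j) (Y j).

Lemma limit_dist i j : i != j ->
  dotv (Y i - Y j) (Y i - Y j) = (if lim_col F c i j then rho else 1) ^+ 2.
Proof.
move=> nij; apply: (rel_pos_dist FF (@hY i) (@hY j)).
apply: (dist_ratio_cvg FF hc nij t20); first exact: scale_t2_cvg.
exact: width_t2_cvg0 FF Foo hc i0F J2.
Qed.

Lemma limit_position_from i j : vcvg F (rel_pos c t2 i j) (Y j - Y i).
Proof.
have h := vcvgB FF (@hY j) (@hY i); move=> k.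
by have := h k; under eq_fun do rewrite rel_pos_sub.
Qed.

Lemma limit_orthogonal i U :
  (forall (t : nat -> R) (j : J) (Y : 'rV[R]_d.+1), i != j -> (forall k, 0 < t k) ->
    F [set k | scale (c k) (c_col (c k) i j) <= t k]%classic ->
    vcvg F (rel_pos c t i j) Y -> dotv U Y = 0) ->
  forall j, dotv U (Y j - Y i) = 0.
Proof.
move=> hU j; have [->|nij] := eqVneq j i; first by rewrite subrr dotvC dotv0l.
apply: (hU t2 j); rewrite 1?eq_sym //; last exact: (@limit_position_from i j).
by apply: filterE => k; apply: scale_le hc k _.
Qed.

(** Comparable scales: the limit is a genuine two-distance set, orthogonal to
    the limit direction at a free point. *)
Lemma comparable_scales_bound : 0 < rho -> (#|J| <= max_two_distance R d)%N.
Proof.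
move=> rho0; have [U [UU hU]] := free_direction FF Foo hc i0F.
have orth := limit_orthogonal hU.
apply: (@hyperplane_family_le_max R d J Y rho 1 U) => //.
- move=> i j nij; have := limit_dist nij; rewrite -eucl_dist_sqr.
  by case: ifP => _ /eqP; rewrite eqrXn2 ?eucl_dist_ge0 ?ltW // => /eqP; [left|right].
- by apply: contra_eq_neq UU => ->; rewrite dotv0l eq_sym oner_eq0.
move=> i j; have := orth i; have := orth j; rewrite !dotvBr dotvBl !(dotvC U); lra.
Qed.

Hypothesis rho0 : rho = 0.

Lemma lim_colE i j : i != j -> lim_col F c i j = (Y i == Y j).
Proof.
move=> nij; have := limit_dist nij; rewrite rho0.
case: (lim_col F c i j) => h.
  by apply/esym/eqP/subr0_eq/dotv_eq0; rewrite h expr0n.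
apply/esym/negbTE; apply: contra_eq_neq h => ->.
by rewrite subrr dotv0l expr1n eq_sym oner_eq0.
Qed.

(** The errors in [cross_estimate] vanish in the limit because [t1 / t2] does. *)
Lemma cross_orthogonal i j l V : i \in free -> i != j -> Y i = Y j -> Y i != Y l ->
  vcvg F (rel_pos c t1 i j) V -> dotv V (Y l - Y i) = 0.
Proof.
move=> iF nij Yij Yil hV.
have nil : i != l by apply: contraNneq Yil => ->.
have njl : j != l by apply: contraNneq Yil => <-; apply/eqP.
have cij : lim_col F c i j by rewrite lim_colE // Yij.
have cji : lim_col F c j i by rewrite lim_colE 1?eq_sym // Yij.
have cil : lim_col F c i l = false by rewrite lim_colE //; apply: negbTE.
have cjl : lim_col F c j l = false by rewrite lim_colE // -Yij; apply: negbTE.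
apply: (ultra_unique FF (dotv_cvg FF hV (@limit_position_from i l))).
pose b k := 2 * (c_w (c k) / t1 k) + 2 * (t1 k / t2 k).
have hb : (b k @[k --> F] --> (0 : R))%classic.
  rewrite -[X in (_ --> X)%classic](_ : 2 * 0 + 2 * 0 = 0 :> R); last by rewrite mulr0 addr0.
  have hw := width_t1_cvg0 FF Foo hc iF nij cij.
  apply: cvgD; first by apply: cvgMl_tmp; exact: hw.
  by apply: cvgMl_tmp; rewrite -rho0.
apply: (@squeeze_cvgr _ _ _ _ (fun k => - b k) b) => //; last first.
  by rewrite -oppr0; apply: cvgN.
have FL : Filter F by exact: filter_filter.
have e12 := @filterI _ F FL _ _ (lim_colP c FF i j) (lim_colP c FF j i).
have e34 := @filterI _ F FL _ _ (lim_colP c FF i l) (lim_colP c FF j l).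
move: (@filterI _ F FL _ _ e12 e34).
apply: filterS => k [[/= e1 e2] [/= e3 e4]].
have d1 := cf_dist (hc k) nil; have d2 := cf_dist (hc k) njl.
have nji : j != i by rewrite eq_sym.
have d3 := cf_dist (hc k) nji.
rewrite e3 cil /scale in d1; rewrite e4 cjl /scale in d2; rewrite e2 cji /scale in d3.
rewrite -ler_norml; apply: cross_estimate => //.
- exact: cf_w (hc k).
- have := width_le hc k iF nij; rewrite e1 cij; apply: le_trans.
  by rewrite ler_peMl ?ler1n // ltW // (cf_w (hc k)).
- exact: cf_t12 (hc k).
Qed.

Lemma cluster_dist h j l Vj Vl : j != l -> Y j = Y l ->
  (c_w (c k) / t1 k @[k --> F] --> (0 : R))%classic ->
  vcvg F (rel_pos c t1 h j) Vj -> vcvg F (rel_pos c t1 h l) Vl ->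
  dotv (Vj - Vl) (Vj - Vl) = 1.
Proof.
move=> njl Yjl hw hj hl; rewrite -(expr1n R 2).
apply: (rel_pos_dist FF hj hl); apply: (dist_ratio_cvg FF hc njl t10) => //.
have -> : lim_col F c j l by rewrite lim_colE // Yjl.
rewrite /scale; under eq_fun do rewrite divff ?gt_eqF ?t10 //.
exact: cvg_cst.
Qed.

Lemma equilateral_dot (a b : 'rV[R]_d.+1) : dotv a a = 1 -> dotv b b = 1 ->
  dotv (a - b) (a - b) = 1 -> dotv a b = 2^-1.
Proof. by rewrite dotvBl !dotvBr (dotvC b a); lra. Qed.

(** Very different scales: at the large scale the clusters become the vertices
    of a regular simplex, at the small scale the cluster of a free point becomes
    another one, and these are orthogonal to each other and to the limit
    direction at that point. *)
Lemma free_cluster_bound i : i \in free ->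
  (#|reps Y| + #|fiber_of Y i| <= d.+2)%N.
Proof.
move=> iF; have [U [UU hU]] := free_direction FF Foo hc iF.
have orth := limit_orthogonal hU.
pose A := fiber_of Y i :\ i; pose B := reps Y :\: fiber_of Y i.
have inA j : j \in A -> [/\ i != j, Y j = Y i & lim_col F c i j].
  rewrite in_setD1 [_ \in fiber_of _ _]inE => /andP[nji /eqP Yji].
  by rewrite lim_colE eq_sym // Yji.
have hwA j : j \in A -> (c_w (c k) / t1 k @[k --> F] --> (0 : R))%classic.
  by move=> /inA[nij _ cij]; have := width_t1_cvg0 FF Foo hc iF nij cij.
have hV j : exists V, j \in A -> vcvg F (rel_pos c t1 i j) V.
  have [/inA[nij Yji cij]|_] := boolP (j \in A); last by exists 0.
  have cji : lim_col F c j i by rewrite lim_colE 1?eq_sym // Yji.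
  suff [V hV] : exists V, vcvg F (rel_pos c t1 i j) V by exists V.
  apply: (rel_pos_cvg FF hc t10).
  have FL : Filter F by exact: filter_filter.
  move: (@filterI _ F FL _ _ (lim_colP c FF i j) (lim_colP c FF j i)).
  apply: filterS => k [/= e1 e2]; right; rewrite e2 cji; split=> //.
  have := width_le hc k iF nij; rewrite e1 cij; apply: le_trans.
  by rewrite ler_peMl ?ler1n // ltW // (cf_w (hc k)).
have [V {}hV] := boolp.choice hV.
have VV j : j \in A -> dotv (V j) (V j) = 1.
  move=> jA; have [nij Yji _] := inA j jA.
  have nji : j != i by rewrite eq_sym.
  have := cluster_dist nji Yji (hwA j jA) (hV j jA) (@rel_pos_self t1 i).
  by rewrite subr0.
have VVjl : {in A &, forall j l, dotv (V j) (V l) = if j == l then 1 else 2^-1}.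
  move=> j l jA lA; have [<-|njl] := eqVneq j l; first exact: VV.
  have [_ Yj _] := inA j jA; have [_ Yl _] := inA l lA.
  apply: equilateral_dot; rewrite ?VV //.
  by apply: (cluster_dist njl _ (hwA j jA) (hV j jA) (hV l lA)); rewrite Yj Yl.
have limY j l : Y j != Y l -> dotv (Y j - Y l) (Y j - Y l) = 1.
  move=> nY; have njl : j != l by apply: contraNneq nY => ->.
  by rewrite limit_dist // lim_colE // (negPf nY) expr1n.
have inB j : j \in B -> j \in reps Y /\ Y j != Y i.
  by rewrite in_setD [_ \in fiber_of _ _]inE => /andP[].
have BB : {in B &, forall j l, dotv (Y j - Y i) (Y l - Y i) = if j == l then 1 else 2^-1}.
  move=> j l jB lB; have [jR nj] := inB j jB; have [lR nl] := inB l lB.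
  have [<-|njl] := eqVneq j l; first exact: limY.
  apply: equilateral_dot; rewrite ?limY // opprB addrA subrK limY //.
  by apply: contraNneq njl => Yjl; apply/eqP; apply: reps_inj Yjl.
have nAB j : j \in A -> j \in B = false.
  by move=> /inA[_ Yj _]; apply/negP => /inB[_]; rewrite Yj eqxx.
pose e j := if j == i then U else if j \in A then V j else Y j - Y i.
have eA j : j \in A -> e j = V j.
  by move=> jA; have [nij _ _] := inA j jA; rewrite /e eq_sym (negPf nij) jA.
have eB j : j \in B -> e j = Y j - Y i.
  move=> jB; have [_ nY] := inB j jB; rewrite /e.
  have -> : (j == i) = false by apply: contraNF nY => /eqP->.
  by case: ifP => // /nAB; rewrite jB.
have ei : e i = U by rewrite /e eqxx.
have iA : i \notin A by rewrite in_setD1 eqxx.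
have iB : i \notin B by apply/negP=> /inB[_]; rewrite eqxx.
have : (#|A| + #|B| < d.+1)%N.
  apply: (@simplices_dim R d.+1 J i A B e iA iB).
  - apply/setP=> j; rewrite in_set0 in_setI; apply/negP => /andP[/nAB-> //].
  - by rewrite ei.
  - move=> j; rewrite in_setU ei => /orP[jA|jB]; last by rewrite eB.
    rewrite eA //; have [nij Yj cij] := inA j jA.
    apply: (hU t1 j _ nij t10); last exact: hV.
    by move: (lim_colP c FF i j); apply: filterS => k /= ->; rewrite cij.
  - by move=> j l jA lA; rewrite !eA // VVjl.
  - by move=> j l jB lB; rewrite !eB // BB.
  move=> j l jA lB; rewrite eA // eB //; have [nij Yj cij] := inA j jA.
  have [_ nY] := inB l lB.
  by apply: (cross_orthogonal iF nij); rewrite 1?eq_sym //; apply: hV.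
have cC : #|fiber_of Y i| = #|A|.+1.
  by rewrite (cardsD1 i (fiber_of Y i)) inE eqxx.
have := cardsID (fiber_of Y i) (reps Y); rewrite reps_fiber cards1 -/B cC; lia.
Qed.
End Positions.

Lemma limit_bound : (#|~: free| <= 2)%N ->
  [\/ (#|J| <= max_two_distance R d)%N, (#|J| <= d.+2)%N |
     exists a b, (a + b = d.+2)%N /\ (#|J| <= a * b)%N].
Proof.
move=> c2; have [rho rho_ge0 hrho] := t1_le_t2_ratio FF hc.
have [Y hY] := limit_positions.
have [rho0|rho0] := eqVneq rho 0; last first.
  by constructor 1; apply: (comparable_scales_bound hrho hY); rewrite lt_def rho0.
have free0 : free != set0 by apply/set0Pn; exists i0.
have [|[a [b [ab Jab]]]] := card_clusters c2 free0
  (fun i iF => @free_cluster_bound rho Y hrho hY rho0 i iF).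
  by constructor 2.
by constructor 3; exists a, b.
Qed.
End LimitBound.

Section NoLargeConfig.
Import mathcomp.boot.fintype mathcomp.boot.finset.

(** Were there configurations for all [K], their limit along an ultrafilter would
    contradict [limit_bound]; this gives [K] without an explicit value. *)
Lemma no_large_config (R : realType) (d : nat) (J : finType) (free : {set J}) :
  (#|~: free| <= 2)%N -> (2 < #|J|)%N -> (max_two_distance R d < #|J|)%N ->
  (d.+2 < #|J|)%N -> (forall a b, a + b = d.+2 -> a * b < #|J|)%N ->
  exists2 K : R, 1 <= K & forall c : config R d.+1 J, ~ is_config free K c.
Proof.
move=> c2 J2 Jm Jd Jab.
case: (pselect (exists2 K : R, 1 <= K & forall c : config R d.+1 J, ~ is_config free K c))
  => // nK; exfalso.
have hc k : exists c : config R d.+1 J, is_config free k.+1%:R c.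
  apply: contrapT => nc; apply: nK; exists k.+1%:R; first by rewrite ler1n.
  by move=> c cK; apply: nc; exists c.
have [c {}hc] := boolp.choice hc.
have [F [FF Foo]] := exists_ultrafilter.
have [i0 i0F] : exists i0, i0 \in free.
  apply/card_gt0P; have := cardsC free; lia.
have ex2 : exists j, i0 != j.
  have : (0 < #|~: [set i0]|)%N by have := cardsC [set i0]; rewrite cards1; lia.
  by move=> /card_gt0P[j]; rewrite !inE => nj; exists j; rewrite eq_sym.
have [h|h|[a [b [ab h]]]] := limit_bound FF Foo hc i0F ex2 c2.
- by move: h; rewrite leqNgt Jm.
- by move: h; rewrite leqNgt Jd.
- by move: h; rewrite leqNgt Jab.
Qed.
End NoLargeConfig.

(** * Alternative positions *)

Section Partners.
Import mathcomp.boot.fintype mathcomp.boot.finset.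
Variable R : realType.

Lemma card_fibers_le (V T : finType) (B : {set V}) (f : V -> T) (L : nat) :
  (forall a, #|[set v in B | f v == a]| <= L)%N -> (#|B| <= #|T| * L)%N.
Proof.
move=> h; rewrite -sum1_card (partition_big f xpredT) //=.
rewrite -sum_nat_const; apply: leq_sum => a _; apply: leq_trans (h a).
by rewrite -sum1_card; apply: eq_leq; apply: eq_bigl => v; rewrite inE.
Qed.

(** Fixing the intervals used towards the points [q], all of [B] lies in one
    ball whose radius is comparable with the shortest distance in use. Two points
    of one cell of a fine grid in this ball are close enough to serve as
    alternative positions of each other, unless they are closer than [K * w]; so
    if none are, each cell contains few points. *)
Lemma card_no_partner (d : nat) (V I : finType) (z : V -> 'rV[R]_d) (B : {set V})
    (q : I -> 'rV[R]_d) (chi : V -> {ffun I -> bool}) (t1 t2 w K : R) (M M' : nat) :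
  0 < t1 -> t1 <= t2 -> 0 < w -> 2 <= K -> (0 < #|I|)%N ->
  4 * d%:R * K <= M%:R -> d%:R * (2 * (K * w)) < M'%:R ->
  (0 < d)%N ->
  (forall u v, u != v -> 1 <= eucl_dist (z u) (z v)) ->
  (forall v j, v \in B ->
     in_interval (if chi v j then t1 else t2) w (eucl_dist (z v) (q j))) ->
  (forall v v', v \in B -> v' \in B -> chi v = chi v' ->
     K * w <= eucl_dist (z v') (z v) ->
     exists j, (if chi v j then t1 else t2) < K * eucl_dist (z v') (z v)) ->
  (#|B| <= 2 ^ #|I| * (M.+1 ^ d * M'.+1 ^ d))%N.
Proof.
move=> t10 t12 w0 K2 I0 hM hM' d0 sep hint bad.
have dR : 1 <= d%:R :> R by rewrite ler1n.
have M0R : 0 < M%:R :> R by apply: lt_le_trans hM; nra.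
have M0 : (0 < M)%N by rewrite -(ltr_nat R).
have Kw0 : 0 < K * w by apply: mulr_gt0 => //; lra.
have M'0 : (0 < M')%N.
  rewrite -(ltr_nat R); apply: lt_trans hM'; apply: mulr_gt0; lra.
have -> : (2 ^ #|I| = #|{ffun I -> bool}|)%N by rewrite card_ffun card_bool.
apply: (card_fibers_le (f := chi)) => phi.
set C := [set v in B | chi v == phi].
have CB v : v \in C -> v \in B /\ chi v = phi.
  by rewrite inE => /andP[-> /eqP].
pose T j := if phi j then t1 else t2.
have [j0 Tj0] : exists j0, forall j, T j0 <= T j.
  have [j1 j1P|nphi] := pickP (fun j => phi j).
    by exists j1 => j; rewrite /T j1P; case: ifP.
  have [j1 _] : exists j1, j1 \in I by apply/card_gt0P.
  by exists j1 => j; rewrite /T !nphi.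
pose tau := Num.max (T j0) w.
have tauT : T j0 <= tau by rewrite le_max lexx.
have tauw : w <= tau by rewrite le_max lexx orbT.
have tau0 : 0 < tau by lra.
apply: (grid_pigeonhole (z := z) (q := q j0) (rho := 2 * tau)) => //; first lra.
  move=> v /CB[vB E] i; apply: le_trans (coord_le_eucl_dist _ _ _) _.
  by have /andP[_] := hint v j0 vB; rewrite E -/(T j0); lra.
move=> D sDC hD.
have near : {in D &, forall u v, K * eucl_dist (z u) (z v) <= tau}.
  move=> u v uD vD.
  have cell0 : 0 <= 2 * (2 * tau) / M%:R by apply: divr_ge0; lra.
  have := eucl_dist_le_coord cell0 (hD u v uD vD) => h.
  apply: (@le_trans _ _ (K * (d%:R * (2 * (2 * tau) / M%:R)))).
    by apply: ler_wpM2l => //; lra.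
  rewrite !mulrA ler_pdivrMr //.
  by have := ler_wpM2r (ltW tau0) hM; lra.
have close : {in D &, forall u v, eucl_dist (z u) (z v) < K * w}.
  move=> u v uD vD; rewrite ltNge; apply/negP => far.
  have [uB cu] := CB u (subsetP sDC u uD).
  have [vB cv] := CB v (subsetP sDC v vD).
  have [j] := bad v u vB uB (etrans cv (esym cu)) far; rewrite cv -/(T j).
  apply/negP; rewrite -leNgt; apply: le_trans (Tj0 j).
  have := near u v uD vD; rewrite /tau; case: (leP (T j0) w) => // _.
  have K0 : 0 <= K by lra.
  have h1 := ler_wpM2l K0 far.
  have h2 := ler_wpM2r (ltW Kw0) K2; have h3 := ler_wpM2r (ltW w0) K2.
  by lra.
have [->|[v0 v0D]] := set_0Vmem D; first by rewrite cards0.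
apply: (card_separated (z := z) (q := z v0) (s := 1) Kw0) => //.
- by rewrite mul1r.
- move=> v vD i; apply: le_trans (coord_le_eucl_dist _ _ _) _.
  by apply: ltW; apply: close.
by move=> u v _ _; apply: sep.
Qed.

Definition upd (V : finType) (r : nat) (u : r.-tuple V) (i : 'I_r) (v : V) : r.-tuple V :=
  [tuple if j == i then v else tnth u j | j < r].

Lemma tnth_upd (V : finType) (r : nat) (u : r.-tuple V) (i : 'I_r) (v : V) j :
  tnth (upd u i v) j = if j == i then v else tnth u j.
Proof. by rewrite tnth_mktuple. Qed.

(** Double counting of the pairs formed by a tuple of [S] and a value for its
    coordinate [i]. *)
Lemma sum_upd (V : finType) (r : nat) (S : {set r.-tuple V}) (i : 'I_r) :
  (\sum_(u : r.-tuple V) #|[set v | upd u i v \in S]| = #|V| * #|S|)%N.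
Proof.
pose h (p : r.-tuple V * V) := (upd p.1 i p.2, tnth p.1 i).
have hK : involutive h.
  case=> u v; rewrite /h /=; congr (_, _); last by rewrite tnth_upd eqxx.
  by apply: eq_from_tnth => j; rewrite !tnth_upd; case: eqP => [->|].
have -> : (\sum_(u : r.-tuple V) #|[set v | upd u i v \in S]| =
    \sum_(p : r.-tuple V * V) ((h p).1 \in S))%N.
  rewrite -(pair_big xpredT xpredT (fun u v => (upd u i v \in S) : nat)) /=.
  apply: eq_bigr => u _; rewrite -sum1_card big_mkcond /=.
  by apply: eq_bigr => v _; rewrite inE; case: (_ \in S).
rewrite -(reindex_inj (inv_inj hK) (P := xpredT) (F := fun p => (p.1 \in S) : nat)) /=.
rewrite -(pair_big xpredT xpredT (fun u (v : V) => (u \in S) : nat)) /=.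
under eq_bigr do rewrite sum_nat_const.
have -> : #|S| = (\sum_(u : r.-tuple V) (u \in S : nat))%N.
  by rewrite -sum1_card big_mkcond; apply: eq_bigr => u _; case: (u \in S).
by rewrite -big_distrr.
Qed.

Lemma card_tuple_set_le (V : finType) (r : nat) (S : {set r.-tuple V}) (i : 'I_r)
    (L : nat) : (0 < #|V|)%N ->
  (forall u, #|[set v | upd u i v \in S]| <= L)%N ->
  (#|V| * #|S| <= #|V| ^ r * L)%N.
Proof.
by move=> V0 h; rewrite -(sum_upd S i) -card_tuple -sum_nat_const; apply: leq_sum => u _.
Qed.
End Partners.

Section CliqueConfig.
Import mathcomp.boot.fintype mathcomp.boot.finset.
Variables (R : realType) (d n r : nat) (z : 'I_n -> 'rV[R]_d) (e : rel 'I_n).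
Variables (t1 t2 w K : R) (x y : 'I_n).
Hypothesis t10 : 0 < t1.
Hypothesis t12 : t1 <= t2.
Hypothesis w0 : 0 < w.
Hypothesis K2 : 2 <= K.
Hypothesis d0 : (0 < d)%N.
Hypothesis sep : forall u v, u != v -> 1 <= eucl_dist (z u) (z v).
Hypothesis esym : symmetric e.
Hypothesis e_int : forall i j, e i j ->
  in_interval t1 w (eucl_dist (z i) (z j)) \/ in_interval t2 w (eucl_dist (z i) (z j)).
Hypothesis exy : e x y.

Let colour i j := t1 <= eucl_dist (z i) (z j) <= t1 + w.
Let sc (b : bool) := if b then t1 else t2.
Let S := cliques_in e (nbrs e setT x :&: nbrs e setT y) r.

Definition clique_point (t : r.-tuple 'I_n) (j : bool + 'I_r) : 'I_n :=
  match j with inl b => if b then x else y | inr i => tnth t i end.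

Lemma e_colour i j : e i j -> in_interval (sc (colour i j)) w (eucl_dist (z i) (z j)).
Proof.
by move=> /e_int h; rewrite /sc /colour; case: ifP => // h1; case: h; rewrite // /in_interval h1.
Qed.

Lemma clique_point_adj t j j' : t \in S -> j != j' ->
  e (clique_point t j) (clique_point t j').
Proof.
rewrite inE => /andP[/all_tnthP tS /(pairwiseP x) tp].
have exi i : e x (tnth t i) by have := tS i; rewrite !inE => /andP[].
have eyi i : e y (tnth t i) by have := tS i; rewrite !inE => /andP[].
have eii (i i' : 'I_r) : (i < i')%N -> e (tnth t i) (tnth t i').
  by move=> ii'; rewrite !(tnth_nth x); apply: tp; rewrite ?inE ?size_tuple.
case: j => [b|i]; case: j' => [b'|i'] /= nj.
- by case: b b' nj => [] []; rewrite ?eqxx // => _; rewrite ?exy // esym.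
- by case: b {nj}.
- by case: b' {nj}; rewrite esym.
have : i != i' by apply: contraNneq nj => ->.
by rewrite -val_eqE neq_ltn => /orP[/eii//|/eii h]; rewrite esym.
Qed.

(** [v'] can replace the [i]-th vertex of the tuple without changing the interval
    used by any distance, and it is neither too close to this vertex nor too far. *)
Definition partner (t : r.-tuple 'I_n) (i : 'I_r) (v' : 'I_n) : Prop :=
  K * w <= eucl_dist (z v') (z (tnth t i)) /\
  forall j, j != inr i ->
    in_interval (sc (colour (tnth t i) (clique_point t j))) w
      (eucl_dist (z v') (z (clique_point t j))) /\
    K * eucl_dist (z v') (z (tnth t i)) <= sc (colour (tnth t i) (clique_point t j)).

Definition no_partner (i : 'I_r) : {set r.-tuple 'I_n} :=
  [set t in S | ~~ `[< exists v', partner t i v' >]].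

Lemma no_partnerP i t : t \in no_partner i -> t \in S /\ ~ exists v', partner t i v'.
Proof. by rewrite [_ \in no_partner i]inE => /andP[tS /asboolPn]. Qed.

Lemma card_no_partner_coord (M M' : nat) (u : r.-tuple 'I_n) (i : 'I_r) :
  4 * d%:R * K <= M%:R -> d%:R * (2 * (K * w)) < M'%:R ->
  (#|[set v | upd u i v \in no_partner i]| <=
     2 ^ (2 + r) * (M.+1 ^ d * M'.+1 ^ d))%N.
Proof.
move=> hM hM'; pose I := {j : bool + 'I_r | j != inr i}.
have updE v (j : I) : clique_point (upd u i v) (val j) = clique_point u (val j).
  case: j => -[b|i'] //= nj; rewrite tnth_upd.
  have ni : i' != i by apply: contraNneq nj => ->.
  by rewrite (negPf ni).
have updi v : tnth (upd u i v) i = v by rewrite tnth_upd eqxx.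
have cI : (#|{: I}| <= 2 + r)%N.
  rewrite card_sig; apply: leq_trans (max_card _) _.
  by rewrite card_sum card_bool card_ord.
apply: (@leq_trans (2 ^ #|{: I}| * (M.+1 ^ d * M'.+1 ^ d))%N); last first.
  by rewrite leq_mul2r leq_exp2l // cI orbT.
apply: (@card_no_partner R d _ I z _ (fun j => z (clique_point u (val j)))
  (fun v => [ffun j => colour v (clique_point u (val j))]) t1 t2 w K) => //.
- by apply/card_gt0P; have h : (inl true : bool + 'I_r) != inr i by []; exists (exist (fun j => is_true (j != inr i)) (inl true) h : I).
- move=> v j; rewrite inE ffunE => /no_partnerP[vS _].
  have nj : inr i != val j by rewrite eq_sym; case: j.
  by have /= := clique_point_adj vS nj; rewrite updE updi => /e_colour.
move=> v v'; rewrite inE => /no_partnerP[vS nv].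
rewrite inE => /no_partnerP[v'S _] E far.
apply: contrapT => nex; apply: nv; exists v'; split; first by rewrite updi.
move=> j nj; pose jI : I := exist (fun j => is_true (j != inr i)) j nj; rewrite updi.
have := updE v jI; rewrite /= => ->; split; last first.
  rewrite leNgt; apply/negP => h; apply: nex; exists jI.
  by rewrite ffunE.
have nj' : inr i != j by rewrite eq_sym.
have := clique_point_adj v'S nj'; rewrite /= updi.
have := updE v' jI; rewrite /= => -> /e_colour.
by have := congr1 (fun f : {ffun I -> bool} => f jI) E; rewrite !ffunE /= => ->.
Qed.

(** For each coordinate only few of the many cliques through the edge [x y] lack
    a partner there, so some clique has partners in all [r] coordinates. *)
Lemma exists_clique_config (M M' : nat) (delta : R) :
  4 * d%:R * K <= M%:R -> d%:R * (2 * (K * w)) < M'%:R ->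
  delta * n%:R ^+ r <= #|S|%:R ->
  (r * (2 ^ (2 + r) * (M.+1 ^ d * M'.+1 ^ d)))%N%:R < delta * n%:R ->
  exists c : config R d (bool + 'I_r)%type, is_config [set inr i | i : 'I_r] K c.
Proof.
move=> hM hM' hS; set L := (2 ^ _ * _)%N => hL.
have n0 : (0 < n)%N by rewrite (leq_trans _ (ltn_ord x)).
have card_bad i : (n * #|no_partner i| <= n ^ r * L)%N.
  have := @card_tuple_set_le _ r (no_partner i) i L; rewrite card_ord; apply=> // u.
  exact: card_no_partner_coord.
have [t tS tgood] : exists2 t, t \in S & forall i, exists v', partner t i v'.
  apply: contrapT => nt.
  have sub : S \subset \bigcup_(i : 'I_r) no_partner i.
    apply/subsetP=> t tS; apply/bigcupP; apply: contrapT => nb; apply: nt.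
    exists t => // i; apply: contrapT => np; apply: nb; exists i => //.
    by rewrite inE tS; apply/asboolPn.
  have : (n * #|S| <= n ^ r * (r * L))%N.
    apply: (@leq_trans (\sum_(i < r) n * #|no_partner i|)%N).
      rewrite -big_distrr leq_mul2l; apply/orP; right.
      apply: leq_trans (subset_leq_card sub) _.
      elim/big_rec2: _ => [|i a b _ ab]; first by rewrite cards0.
      by apply: leq_trans (leq_card_setU _ _).1 _; rewrite leq_add2l.
    apply: (@leq_trans (\sum_(i < r) n ^ r * L)%N); first by apply: leq_sum.
    by rewrite sum_nat_const card_ord mulnCA.
  rewrite -(ler_nat R) natrM [X in _ <= X]natrM natrX => h3.
  have nr : 0 < n%:R ^+ r :> R by rewrite exprn_gt0 ?ltr0n.
  have h1 : n%:R * (delta * n%:R ^+ r) <= n%:R * #|S|%:R :> R by rewrite ler_wpM2l.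
  have h2 := hL; rewrite -(ltr_pM2l nr) in h2.
  move: h1 h2 h3; move: (n%:R ^+ r : R) (n%:R : R) (#|S|%:R : R).
  by move: ((r * L)%:R : R) => l a b s; lra.
have [v' hv'] := boolp.choice tgood.
pose c := Config t1 t2 w (fun j => z (clique_point t j))
  (fun j => match j with inl _ => 0 | inr i => z (v' i) end)
  (fun j j' => colour (clique_point t j) (clique_point t j')).
exists c; split=> //=.
- by move=> j j' nj; apply: e_colour; apply: clique_point_adj.
- by move=> _ j /imsetP[i _ ->] nj; have [_ h] := hv' i; case: (h j) => //; rewrite eq_sym.
- by move=> _ /imsetP[i _ ->]; have [h _] := hv' i.
by move=> _ j /imsetP[i _ ->] nj; have [_ h] := hv' i; case: (h j) => //; rewrite eq_sym.
Qed.
End CliqueConfig.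

(** * The upper bound *)

Section UpperBound.
Import mathcomp.boot.fintype mathcomp.boot.finset.
Variable R : realType.

Definition pt (d : nat) (P : {fset 'rV[R]_d}) (i : 'I_(#|` P|)) : 'rV[R]_d :=
  nth 0 (enum_fset P) i.

Definition dist_rel (d n : nat) (z : 'I_n -> 'rV[R]_d) (D : set R) : rel 'I_n :=
  fun i j => (i != j) && (eucl_dist (z i) (z j) \in D).

Lemma pt_in (d : nat) (P : {fset 'rV[R]_d}) i : pt (P := P) i \in P.
Proof. exact: mem_nth. Qed.

Lemma pt_inj (d : nat) (P : {fset 'rV[R]_d}) : injective (pt (P := P)).
Proof.
move=> i j /eqP; rewrite nth_uniq ?fset_uniq // => /eqP ij.
exact: val_inj.
Qed.

Lemma npairs_le_edges (d : nat) (P : {fset 'rV[R]_d}) (D : set R) :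
  (npairs P D <= #|edges_of (dist_rel (pt (P := P)) D)|)%N.
Proof.
pose F (B : {set 'I_(#|` P|)}) := [fset pt i | i in B]%fset.
rewrite /npairs cardE -(size_map F) /=.
have -> : size [seq F i | i <- enum (edges_of (dist_rel (pt (P:=P)) D))] =
  size (map F (enum (edges_of (dist_rel (pt (P:=P)) D)))) by [].
apply: uniq_leq_size; first exact: fset_uniq.
move=> B /imfset2P[x xP [y]]; rewrite inE => /andP[yP /andP[nxy xyD] ->].
have [i Ei] : exists i : 'I_(#|` P|), x = pt i.
  by have := xP; rewrite -index_mem => h; exists (Ordinal h); rewrite /pt nth_index.
have [j Ej] : exists j : 'I_(#|` P|), y = pt j.
  by have := yP; rewrite -index_mem => h; exists (Ordinal h); rewrite /pt nth_index.
apply/mapP; exists [set i; j].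
  rewrite mem_enum inE; apply/existsP; exists i; apply/existsP; exists j.
  rewrite eqxx andbT /dist_rel -Ei -Ej xyD andbT.
  by apply: contraNneq nxy => ij; rewrite Ei Ej ij.
apply/fsetP=> u; rewrite Ei Ej in_fset2; apply/orP/imfsetP => /=.
  by case=> /eqP ->; [exists i; rewrite ?set21|exists j; rewrite ?set22].
by case=> k /set2P[] -> ->; [left|right].
Qed.

Lemma in_near_two (t1 t2 w x : R) :
  x \in near_two t1 t2 w <-> in_interval t1 w x \/ in_interval t2 w x.
Proof. by rewrite in_setE /near_two /setU /= !in_itv. Qed.

Lemma near_twoC (t1 t2 w : R) : near_two t1 t2 w = near_two t2 t1 w.
Proof. by rewrite /near_two classical_sets.setUC. Qed.

Lemma is_config_le (d : nat) (J : finType) (free : {set J}) (K K' : R)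
    (c : config R d J) : K <= K' -> is_config free K' c -> is_config free K c.
Proof.
move=> KK' [h1 h2 h3 h4 h5 h6 h7]; split=> // [i iF|i j iF nij].
  by apply: le_trans (h6 i iF); apply: ler_wpM2r => //; apply: ltW.
apply: le_trans (h7 i j iF nij); apply: ler_wpM2r => //.
exact: eucl_dist_ge0.
Qed.

(** If the bound failed, the graph of near-distances would have many cliques on
    [m + 1] vertices through one edge, and, since [w] is a small multiple of
    [n ^ (1 / d)], one of them would be a configuration excluded by
    [no_large_config]. *)
Lemma npairs_le_turan (d : nat) : (2 <= d)%N -> exists (c : R) (n0 : nat),
  [/\ 0 < c, (0 < n0)%N & forall (t1 t2 : R) (P : {fset 'rV[R]_d}),
    1 <= t1 -> 1 <= t2 -> unit_separated P -> (n0 <= #|` P|)%N ->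
    (npairs P (near_two t1 t2 (c * #|` P|%:R `^ (d%:R^-1)))
       <= turan (max_two_distance R d.-1).+1 #|` P|)%N].
Proof.
case: d => [//|d] d1 /=; have {}d1 : (1 <= d)%N by [].
have [m_ge m_ab] := max_two_distance_ge R d1.
set m := max_two_distance R d in m_ge m_ab *.
have [r r0 mE] : exists2 r, (0 < r)%N & m = r.+1 by exists m.-1; lia.
pose free : {set bool + 'I_r} := [set inr i | i : 'I_r].
have cJ : #|{: bool + 'I_r}| = m.+1 by rewrite card_sum card_bool card_ord mE.
have cfree : (#|~: free| <= 2)%N.
  have -> : ~: free = [set inl b | b : bool].
    apply/setP=> -[b|i]; rewrite inE.
      have -> : (inl b : bool + 'I_r) \in [set inl b | b : bool] by apply/imsetP; exists b.
      by apply/imsetP => -[].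
    by rewrite imset_f //; apply/esym/negbTE/imsetP => -[].
  by apply: leq_trans (leq_imset_card _ _) _; rewrite card_bool.
have J2 : (2 < #|{: bool + 'I_r}|)%N by rewrite cJ; lia.
have Jm : (m < #|{: bool + 'I_r}|)%N by rewrite cJ.
have Jd : (d.+2 < #|{: bool + 'I_r}|)%N by rewrite cJ.
have Jab a b : (a + b = d.+2)%N -> (a * b < #|{: bool + 'I_r}|)%N.
  by move=> ab; rewrite cJ ltnS; apply: m_ab.
have [K0 K01 noconf] := no_large_config cfree J2 Jm Jd Jab.
pose K : R := K0 + 1.
have Kpos : 0 < K by rewrite /K; lra.
have [delta [N0 [delta0 hcl]]] := many_cliques_through_edge R r0.
pose D : R := d.+1%:R.
have D1 : 1 <= D by rewrite ler1n.
pose M := Num.bound (4 * D * K).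
have hM : 4 * D * K <= M%:R.
  by apply: ltW; apply: archi_boundP; rewrite /K; do ?apply: mulr_ge0; lra.
pose A := (r * (2 ^ (2 + r) * M.+1 ^ d.+1))%N.
(* [theta] bounds the number of points at distance less than [K * w] from one of
   them, as a fraction of [n]. *)
pose theta : R := Num.min 1 (delta / (A%:R + 1)).
have A0 : 0 <= A%:R :> R by rewrite ler0n.
have theta0 : 0 < theta.
  by rewrite lt_min ltr01 /=; apply: divr_gt0; lra.
have theta1 : theta <= 1 by rewrite ge_min lexx.
have Atheta : A%:R * theta < delta.
  have : theta <= delta / (A%:R + 1) by rewrite ge_min lexx orbT.
  rewrite ler_pdivlMr; last lra.
  by nra.
pose c : R := theta / (4 * D * K).
have DK0 : 0 < 4 * D * K by rewrite /K; do ?apply: mulr_gt0; lra.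
have c0 : 0 < c by apply: divr_gt0.
pose n0 := (maxn N0 (Num.bound ((4 / theta) ^+ d.+1))).+1.
exists c, n0; split=> // t1 t2 P t11 t21 sepP nP.
wlog t12 : t1 t2 t11 t21 / t1 <= t2 => [hw|].
  have [|/ltW] := leP t1 t2; first exact: hw.
  by rewrite near_twoC; apply: hw.
set n := #|` P| in nP *.
have [N0n Nbn] : (N0 <= n /\ Num.bound ((4 / theta) ^+ d.+1) <= n)%N.
  by split; apply: leq_trans (ltnW nP); rewrite ?leq_maxl ?leq_maxr.
have n_gt0 : 0 < n%:R :> R by rewrite ltr0n; apply: leq_trans nP.
set nu := n%:R `^ _.
have nu0 : 0 < nu by apply: powR_gt0.
have nuE : nu ^+ d.+1 = n%:R.
  by rewrite -powR_mulrn ?powR_ge0 // -powRrM mulVf ?powRr1 // ltW.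
have nubig : 4 / theta <= nu.
  rewrite -(@ler_pXn2r _ d.+1) ?nnegrE ?(ltW nu0) //; last by apply: divr_ge0; lra.
  rewrite nuE; apply: (@le_trans _ _ (Num.bound ((4 / theta) ^+ d.+1))%:R).
    by apply: ltW; apply: archi_boundP; apply: exprn_ge0; apply: divr_ge0; lra.
  by rewrite ler_nat.
pose w : R := c * nu.
have w0 : 0 < w by apply: mulr_gt0.
rewrite -/w leqNgt; apply/negP => big.
pose e := dist_rel (pt (P := P)) (near_two t1 t2 w).
have esym : symmetric e by move=> i j; rewrite /e /dist_rel eq_sym eucl_distC.
have eirr : irreflexive e by move=> i; rewrite /e /dist_rel eqxx.
have Ebig := leq_trans big (npairs_le_edges P _).
have := hcl n (edges_of e) N0n (simple_edges_of eirr).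
rewrite -mE => /(_ Ebig)[x [y [exy]]].
have -> : adj (edges_of e) = e.
  by apply/funext=> i; apply/funext=> j; apply: adj_edges_of.
rewrite adj_edges_of // in exy; move=> hS.
pose X : R := D * (2 * (K * w)).
have X0 : 0 <= X.
  apply: mulr_ge0; first exact: le_trans ler01 D1.
  by apply: mulr_ge0 => //; apply: mulr_ge0; apply: ltW.
pose M' := (Num.truncn X).+1.
have /andP[X1 X2] := truncn_itv X0.
have hXE : X = theta / 2 * nu.
  have cE : c * (4 * D * K) = theta by rewrite divfK // gt_eqF.
  by rewrite -cE /X /w; move: (c) (D) (K) (nu) => c1 D2 K1 nu1; field.
have M'small : M'.+1%:R <= theta * nu.
  have h4 : 4 <= theta * nu by move: nubig; rewrite ler_pdivrMr // mulrC.
  by rewrite -natr1 /M' -natr1; move: hXE X1 h4; lra.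
have small : (r * (2 ^ (2 + r) * (M.+1 ^ d.+1 * M'.+1 ^ d.+1)))%N%:R < delta * n%:R.
  rewrite (_ : (_ * _)%N = (A * M'.+1 ^ d.+1)%N); last by rewrite /A !mulnA.
  rewrite natrM natrX; apply: (@le_lt_trans _ _ (A%:R * (theta * n%:R))); last first.
    by rewrite mulrA ltr_pM2r.
  apply: ler_wpM2l => //; apply: (@le_trans _ _ ((theta * nu) ^+ d.+1)).
    by apply: lerXn2r => //; rewrite nnegrE // mulr_ge0 // ltW.
  rewrite exprMn nuE; apply: ler_wpM2r; first exact: ltW.
  by rewrite exprS ler_piMr ?(ltW theta0) // exprn_ile1 // ltW.
have t10 : 0 < t1 := lt_le_trans ltr01 t11.
have K2 : 2 <= K by rewrite /K; lra.
have sepz (i j : 'I_n) : i != j -> 1 <= eucl_dist (pt (P := P) i) (pt j).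
  move=> nij; apply: sepP; rewrite ?pt_in //.
  by apply: contraNneq nij => /pt_inj ->.
have e_int i j : e i j -> in_interval t1 w (eucl_dist (pt (P := P) i) (pt j)) \/
    in_interval t2 w (eucl_dist (pt (P := P) i) (pt j)).
  by move=> /andP[_ /in_near_two].
have [c' hc'] := exists_clique_config t10 t12 w0 K2 (ltn0Sn d) sepz esym e_int exy hM X2 hS small.
by apply: (noconf c'); apply: is_config_le hc'; rewrite lerDl.
Qed.
End UpperBound.

(** * Sharpness *)

Section LowerBound.
Import mathcomp.boot.fintype mathcomp.boot.finset.
Variable R : realType.

(** Each point of a hugely dilated two-distance set of the hyperplane is replaced
    by equally spaced points of the line through it orthogonal to the hyperplane:
    along lines of fewer than [n] steps, the distance between points on different
    lines exceeds [t] by less than [n ^ 2 / t]. *)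
Definition column_point (d : nat) (s : 'rV[R]_d) (k : nat) : 'rV[R]_d.+1 :=
  \row_i (if unlift 0 i is Some j then s 0 j else k%:R).

Lemma column_point_dist (d : nat) (s s' : 'rV[R]_d) (k k' : nat) :
  eucl_dist (column_point s k) (column_point s' k') ^+ 2 =
  (k%:R - k'%:R) ^+ 2 + eucl_dist s s' ^+ 2.
Proof.
rewrite !eucl_dist_sqr /dotv big_ord_recl !mxE unlift_none expr2; congr (_ + _).
by apply: eq_bigr => i _; rewrite !mxE liftK.
Qed.

Lemma eucl_distZ (d : nat) (a : R) (x y : 'rV[R]_d) : 0 <= a ->
  eucl_dist (a *: x) (a *: y) = a * eucl_dist x y.
Proof.
move=> a0; rewrite !eucl_distE -scalerBr dotvZl dotvZr mulrA -expr2.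
by rewrite sqrtrM ?sqr_ge0 // sqrtr_sqr ger0_norm.
Qed.

Lemma column_point_near (d : nat) (s s' : 'rV[R]_d) (k k' n : nat) (t w : R) :
  0 < t -> 0 <= w -> n%:R ^+ 2 <= t * w -> (k < n)%N -> (k' < n)%N -> eucl_dist s s' = t ->
  t <= eucl_dist (column_point s k) (column_point s' k') <= t + w.
Proof.
move=> t0 w0 htw kn k'n st; have := column_point_dist s s' k k'; rewrite st.
set u := eucl_dist _ _ => uE; have u0 : 0 <= u by apply: eucl_dist_ge0.
have kk : (k%:R - k'%:R) ^+ 2 <= n%:R ^+ 2 :> R.
  rewrite -[leLHS]real_normK ?num_real // lerXn2r ?nnegrE // ler_norml.
  have [h1 h2] : k%:R <= n%:R :> R /\ k'%:R <= n%:R :> R by split; rewrite ler_nat ltnW.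
  have [h3 h4] : 0 <= k%:R :> R /\ 0 <= k'%:R :> R by split; rewrite ler0n.
  by apply/andP; split; lra.
apply/andP; split; rewrite -(@ler_pXn2r _ 2) ?nnegrE ?addr_ge0 ?(ltW t0) // uE.
  by rewrite lerDr sqr_ge0.
rewrite sqrrD; have := mulr_ge0 w0 w0; have := mulr_ge0 (ltW t0) w0.
by rewrite expr2 in kk htw *; rewrite !expr2 mulr2n; lra.
Qed.

Lemma npairs_ge_edges (d n : nat) (z : 'I_n -> 'rV[R]_d) (E : {set {set 'I_n}})
    (D : set R) :
  injective z -> simple_graph E ->
  (forall i j, [set i; j] \in E -> eucl_dist (z i) (z j) \in D) ->
  (#|E| <= npairs [fset z i | i : 'I_n]%fset D)%N.
Proof.
move=> zinj sE hD; pose F (B : {set 'I_n}) := [fset z i | i in B]%fset.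
have Finj : injective F.
  move=> B C FBC; apply/setP=> i.
  have mF (A : {set 'I_n}) : (z i \in F A) = (i \in A).
    apply/imfsetP/idP => [[j /= jA /zinj ->] //|iA]; by exists i.
  by rewrite -!mF FBC.
rewrite cardE -(size_map F) /npairs.
apply: uniq_leq_size; first by rewrite map_inj_uniq // enum_uniq.
move=> _ /mapP[B + ->]; rewrite mem_enum => BE.
have /eqP/cards2P[i [j [nij EB]]] : #|B| = 2%N.
  by apply/eqP; apply: (implyP (forallP sE B)).
apply/imfset2P; exists (z i); first by apply/imfsetP; exists i.
exists (z j).
  rewrite inE; apply/andP; split; first by apply/imfsetP; exists j.
  by rewrite (inj_eq zinj) nij; apply: hD; rewrite -EB.
apply/fsetP=> u; rewrite in_fset2 EB; apply/imfsetP/orP => /=.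
  by case=> k /set2P[] -> ->; [left|right].
by case=> /eqP ->; [exists i; rewrite ?set21|exists j; rewrite ?set22].
Qed.

Lemma turan_le_npairs (d n : nat) (w : R) : (2 <= d)%N -> 0 < w ->
  exists (t1 t2 : R) (P : {fset 'rV[R]_d}),
    [/\ 1 <= t1, 1 <= t2, unit_separated P, #|` P| = n &
     (turan (max_two_distance R d.-1).+1 n <= npairs P (near_two t1 t2 w))%N].
Proof.
case: d => [//|d] d1 w0 /=; have {}d1 : (1 <= d)%N by [].
have [[S S2 cS] _] := max_two_distanceP R d.
have [m_ge _] := max_two_distance_ge R d1.
set m := max_two_distance R d in cS m_ge *.
have m0 : (0 < m)%N by lia.
have [a [b [a0 ab hS]]] := two_distanceP S2.
have [f [hf le_f]] := turan_coloring n m0.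
(* The first bound makes the distances at least [1], the second one makes [n]
   unit steps across them negligible compared with [w]. *)
pose lam := Num.max (1 / a) (n%:R ^+ 2 / (a * w)).
have lam1 : 1 <= lam * a by rewrite -ler_pdivrMr // le_max lexx.
have lam2 : n%:R ^+ 2 <= lam * a * w.
  by rewrite -mulrA -ler_pdivrMr ?mulr_gt0 // le_max lexx orbT.
have lam0 : 0 < lam by rewrite lt_max divr_gt0.
pose t1 := lam * a; pose t2 := lam * b.
have t12 : t1 <= t2 by apply: ler_wpM2l => //; apply: ltW.
have t10 : 0 < t1 by apply: mulr_gt0.
pose s (i : 'I_n) : 'rV[R]_d := lam *: nth 0 (enum_fset S) (f i).
pose z i := column_point (s i) i.
have sdist i j : f i != f j -> eucl_dist (s i) (s j) = t1 \/ eucl_dist (s i) (s j) = t2.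
  move=> nf; rewrite eucl_distZ ?(ltW lam0) //.
  have fS k : nth 0 (enum_fset S) (f k) \in S by apply: mem_nth; rewrite cS.
  have nS : [` fS i]%fset != [` fS j]%fset.
    by rewrite -val_eqE /= nth_uniq ?cS ?fset_uniq.
  by case: (hS _ _ nS) => /= ->; [left|right].
have zsep i j : i != j -> 1 <= eucl_dist (z i) (z j).
  move=> nij; rewrite -(@ler_pXn2r _ 2) ?nnegrE ?eucl_dist_ge0 // expr1n.
  rewrite column_point_dist.
  have : 1 <= (i%:R - j%:R) ^+ 2 :> R.
    have : (1 <= (i%:Z - j%:Z) ^+ 2)%R.
      have : i%:Z - j%:Z != 0 by rewrite subr_eq0 eqz_nat val_eqE.
      by rewrite expr2; nia.
    by rewrite -(ler_int R) rmorphXn rmorphB /=.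
  by have := sqr_ge0 (eucl_dist (s i) (s j)); lra.
have zinj : injective z.
  move=> i j zij; apply/eqP; apply: contraT => /zsep.
  by rewrite zij eucl_distxx ler10.
exists t1, t2, [fset z i | i : 'I_n]%fset; split=> //.
- by apply: le_trans lam1 t12.
- move=> _ _ /imfsetP[i _ ->] /imfsetP[j _ ->] nz; apply: zsep.
  by apply: contraNneq nz => ->.
- by rewrite card_imfset //= size_enum_ord.
have fsym : symmetric (diff_color f) by move=> i j; rewrite /diff_color eq_sym.
have firr : irreflexive (diff_color f) by move=> i; rewrite /diff_color eqxx.
apply: (@leq_trans #|edges_of (diff_color f)|).
  rewrite -leq_double -card_edges ?simple_edges_of //.
  apply: leq_trans le_f _; apply: eq_leq; apply: eq_bigr => i _.
  by apply: eq_card => j; rewrite !inE adj_edges_of.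
apply: npairs_ge_edges => //; first exact: simple_edges_of.
move=> i j ijE; have fij : f i != f j.
  by rewrite -/(diff_color f i j) -(adj_edges_of fsym firr).
apply/in_near_two; have [st|st] := sdist i j fij; [left|right];
  apply: (column_point_near (n := n) _ (ltW w0) _ (ltn_ord i) (ltn_ord j) st) => //.
  by apply: lt_le_trans t12.
by apply: le_trans lam2 _; apply: ler_wpM2r => //; apply: ltW.
Qed.
End LowerBound.

(** * The theorem *)

Section Assembly.
Variable R : realType.

Lemma npairs_mono (d : nat) (P : {fset 'rV[R]_d}) (D D' : set R) :
  (forall x, x \in D -> x \in D') -> (npairs P D <= npairs P D')%N.
Proof.
move=> DD'; apply: fsubset_leq_card; apply/fsubsetP => B.
case/imfset2P => x xP [y]; rewrite inE => /andP[yP /andP[nxy xyD]] ->.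
apply/imfset2P; exists x => //; exists y => //.
by rewrite inE; apply/andP; split=> //; rewrite nxy DD'.
Qed.

Lemma near_two_mono (t1 t2 w w' : R) x : w <= w' ->
  x \in near_two t1 t2 w -> x \in near_two t1 t2 w'.
Proof.
move=> ww' /in_near_two h; apply/in_near_two.
by case: h => /andP[h1 h2]; [left|right]; apply/andP; split=> //; lra.
Qed.

Lemma turan_asymptotics (m : nat) : (0 < m)%N -> exists C : R, forall n : nat,
  (1 <= n)%N ->
  `| (turan m.+1 n)%:R - n%:R ^+ 2 / 2 * (1 - m%:R^-1) | <= C.
Proof.
move=> m0; exists (m%:R / 2) => n _; rewrite ler_norml.
have := turan_le R n m0; have := turan_ge R n m0.
have : 0 <= m%:R / 2 :> R by apply: divr_ge0.
by move=> h1 h2 h3; apply/andP; split; lra.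
Qed.

(** The logarithmic width is smaller than the power width, and the Turan number
    is below the stated density. *)
Lemma npairs_le_log (d : nat) (eps : R) : (2 <= d)%N -> 0 < eps ->
  exists (c : R) (n0 : nat), [/\ 0 < c, (0 < n0)%N &
    forall (t1 t2 : R) (P : {fset 'rV[R]_d}),
      1 <= t1 -> 1 <= t2 -> unit_separated P -> (n0 <= #|` P|)%N ->
      (npairs P (near_two t1 t2 (c * (ln #|` P|%:R) `^ (d%:R^-1))))%:R
        <= #|` P|%:R ^+ 2 / 2 * (1 - (max_two_distance R d.-1)%:R^-1 + eps)].
Proof.
move=> d2 eps0; have [c [n0 [c0 n00 h]]] := npairs_le_turan R d2.
exists c, n0; split=> // t1 t2 P t11 t21 sepP nP.
have n1 : (1 <= #|` P|)%N by apply: leq_trans nP.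
have := h t1 t2 P t11 t21 sepP nP; set n := #|` P| in n1 *.
have d1 : (1 <= d.-1)%N by lia.
have [m_ge _] := max_two_distance_ge R d1.
have m0 : (0 < max_two_distance R d.-1)%N by lia.
have := turan_le R n m0; set T := turan _ _ => hT hP.
have ww : c * (ln n%:R) `^ (d%:R^-1) <= c * n%:R `^ (d%:R^-1).
  apply: ler_wpM2l; first exact: ltW.
  have nR : 1 <= n%:R :> R by rewrite ler1n.
  apply: ge0_ler_powR; rewrite ?nnegrE ?invr_ge0 ?ler0n ?ln_ge0 //.
  have := @le_ln1Dx R (n%:R - 1).
  by rewrite addrCA subrr addr0; move=> /(_ _) h1; apply: le_trans (h1 _) _; lra.
apply: (@le_trans _ _ T%:R).
  rewrite ler_nat; apply: leq_trans hP; apply: npairs_mono => x.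
  exact: near_two_mono.
apply: (le_trans hT); apply: ler_wpM2l; first by apply: divr_ge0 => //; apply: sqr_ge0.
by rewrite lerDl ltW.
Qed.

Lemma turan_le_npairs_log (d n : nat) (c : R) : (2 <= d)%N -> (1 <= n)%N -> 0 < c ->
  exists (t1 t2 : R) (P : {fset 'rV[R]_d}),
    [/\ 1 <= t1, 1 <= t2, unit_separated P, #|` P| = n &
     (turan (max_two_distance R d.-1).+1 n
        <= npairs P (near_two t1 t2 (c * (ln n%:R) `^ (d%:R^-1))))%N].
Proof.
move=> d2 n1 c0; have [n2|n2] := leqP 2 n.
  apply: turan_le_npairs => //; apply: mulr_gt0 => //; apply: powR_gt0.
  by apply: ln_gt0; rewrite ltr1n.
(* For [n = 1] the width vanishes, and so does the Turan number. *)
have -> : n = 1%N by lia.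
have [t1 [t2 [P [t11 t21 sepP cP _]]]] := turan_le_npairs 1 d2 (@ltr01 R).
exists t1, t2, P; split=> //.
have d1 : (1 <= d.-1)%N by lia.
have [m_ge _] := max_two_distance_ge R d1.
have m0 : (0 < max_two_distance R d.-1)%N by lia.
suff -> : turan (max_two_distance R d.-1).+1 1 = 0%N by [].
apply/eqP; rewrite -leqn0 -ltnS -(ltr_nat R); apply: le_lt_trans (turan_le R 1 m0) _.
have : 0 < (max_two_distance R d.-1)%:R^-1 :> R by rewrite invr_gt0 ltr0n.
by rewrite expr1n; lra.
Qed.
End Assembly.

Theorem theorem1 (R : realType) :
  (* (i) *)
  (forall d : nat, (2 <= d)%N -> d <> 4%N -> d <> 5%N ->
     (exists (c : R) (n0 : nat), [/\ 0 < c, (0 < n0)%N &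
        forall (t1 t2 : R) (P : {fset 'rV[R]_d}),
          1 <= t1 -> 1 <= t2 -> unit_separated P -> (n0 <= #|` P|)%N ->
          (npairs P (near_two t1 t2 (c * #|` P|%:R `^ (d%:R^-1)))
             <= turan (max_two_distance R d.-1).+1 #|` P|)%N]) /\
     (exists C : R, forall n : nat, (1 <= n)%N ->
        `| (turan (max_two_distance R d.-1).+1 n)%:R
             - n%:R ^+ 2 / 2 * (1 - (max_two_distance R d.-1)%:R^-1) | <= C)) /\
  (* (ii) *)
  (forall d : nat, d = 4%N \/ d = 5%N ->
     forall eps : R, 0 < eps ->
     exists (c : R) (n0 : nat), [/\ 0 < c, (0 < n0)%N &
        forall (t1 t2 : R) (P : {fset 'rV[R]_d}),
          1 <= t1 -> 1 <= t2 -> unit_separated P -> (n0 <= #|` P|)%N ->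
          (npairs P (near_two t1 t2 (c * (ln #|` P|%:R) `^ (d%:R^-1))))%:R
            <= #|` P|%:R ^+ 2 / 2 * (1 - (max_two_distance R d.-1)%:R^-1 + eps)]) /\
  (* (iii) *)
  (forall d n : nat, (2 <= d)%N -> (1 <= n)%N ->
     forall c : R, 0 < c ->
     (d <> 4%N -> d <> 5%N ->
        exists (t1 t2 : R) (P : {fset 'rV[R]_d}),
          [/\ 1 <= t1, 1 <= t2, unit_separated P, #|` P| = n &
           (turan (max_two_distance R d.-1).+1 n
              <= npairs P (near_two t1 t2 (c * n%:R `^ (d%:R^-1))))%N]) /\
     (d = 4%N \/ d = 5%N ->
        exists (t1 t2 : R) (P : {fset 'rV[R]_d}),
          [/\ 1 <= t1, 1 <= t2, unit_separated P, #|` P| = n &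
           (turan (max_two_distance R d.-1).+1 n
              <= npairs P (near_two t1 t2 (c * (ln n%:R) `^ (d%:R^-1))))%N])).
Proof.
have max_gt0 d : (2 <= d)%N -> (0 < max_two_distance R d.-1)%N.
  by case: d => [|[|d]] // _; have [h _] := max_two_distance_ge R (ltn0Sn d); apply: leq_trans h.
split=> [d d2 _ _|].
  by split; [apply: npairs_le_turan | apply: turan_asymptotics; apply: max_gt0].
split=> [d d45 eps eps0|d n d2 n1 c c0].
  by apply: npairs_le_log => //; case: d45 => ->.
split=> [_ _|_]; last exact: turan_le_npairs_log.
by apply: turan_le_npairs => //; apply: mulr_gt0 => //; apply: powR_gt0; rewrite ltr0n.
Qed.
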